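(* Let $\Gamma$ be a countably infinite group. Then $\Gamma$ has property $\mathrm{MD}$ if and only if $\Gamma$ has property $\mathrm{EMD}^*$.
   Context: A measure preserving action $\bm{a}=\Gamma\curvearrowright^a(X,\mu)$ of a countable group $\Gamma$ is a Borel action $a$ of $\Gamma$ on a standard Borel space $X$ preserving a Borel probability measure $\mu$ on $X$; write $\gamma^a x$ for the action of $\gamma$ on $x$. Weak containment: for $\bm{a}$ on $(X,\mu)$ and $\bm{b}$ on $(Y,\nu)$, $\bm{a}\prec\bm{b}$ means that for every finite measurable partition $A_0,\dots,A_{k-1}$ of $X$, every finite $F\subseteq\Gamma$, and every $\epsilon>0$ there is a measurable partition $B_0,\dots,B_{k-1}$ of $Y$ with $|\mu(\gamma^aA_i\cap A_j)-\nu(\gamma^bB_i\cap B_j)|<\epsilon$ for all $\gamma\in F$ and $i,j<k$. Let $\bm{p}_\Gamma$ denote the action of $\Gamma$ by left translation (via the canonical homomorphism) on its profinite completion, equipped with normalized Haar measure (if the profinite completion is not metrizable, the definition of weak containment is applied verbatim to this probability space). Let $\bm{\iota}$ denote the identity action of $\Gamma$ on a standard non-atomic probability space, and $\bm{\iota}\times\bm{p}_\Gamma$ the product action with product measure. $\Gamma$ has property $\mathrm{EMD}^*$ if $\bm{b}\prec\bm{p}_\Gamma$ for every ergodic measure preserving action $\bm{b}$ of $\Gamma$. $\Gamma$ has property $\mathrm{MD}$ if $\bm{b}\prec\bm{\iota}\times\bm{p}_\Gamma$ for every measure preserving action $\bm{b}$ of $\Gamma$. *)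

(* Defs.v *)
From HB Require Import structures.
From mathcomp Require Import all_boot all_order all_algebra.
From mathcomp Require Import all_classical all_reals all_analysis.

Set Implicit Arguments.
Unset Strict Implicit.
Unset Printing Implicit Defensive.

Import Order.TTheory GRing.Theory Num.Theory.
Import numFieldNormedType.Exports.

Local Open Scope ring_scope.
Local Open Scope classical_set_scope.

Section Actions.
Variables (Gamma : groupType) (R : realType).

Record mp_action d (X : measurableType d) (mu : probability X R) := MpAction {
  act :> Gamma -> X -> X;
  act1 : forall x, act 1%g x = x;
  actM : forall g h x, act (g * h)%g x = act g (act h x);
  act_measurable : forall g, measurable_fun [set: X] (act g);
  act_preserving : forall g A, measurable A -> mu (act g @^-1` A) = mu A
}.

Definition ergodic d (X : measurableType d) (mu : probability X R)
    (a : mp_action mu) :=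
  forall A : set X, measurable A -> (forall g, a g @` A = A) ->
    mu A = 0%E \/ mu A = 1%E.

(* Pieces of a partition may be empty, hence no use of the library's
   [partition], which requires nonempty pieces. *)
Definition measurable_partition d (X : measurableType d) (k : nat)
    (A : 'I_k -> set X) :=
  [/\ forall i, measurable (A i), trivIset [set: 'I_k] A &
      \bigcup_i A i = [set: X]].

Definition weakly_contained dX dY (X : measurableType dX)
    (Y : measurableType dY) (mu : probability X R) (nu : probability Y R)
    (a : mp_action mu) (b : mp_action nu) :=
  forall (k : nat) (A : 'I_k -> set X) (F : set Gamma) (e : R),
    measurable_partition A -> finite_set F -> 0 < e ->
    exists2 B : 'I_k -> set Y, measurable_partition B &
      forall g i j, F g ->
        (`| mu ((a g @` A i) `&` A j) - nu ((b g @` B i) `&` B j) | < e%:E)%E.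

End Actions.

Notation "a ≺ b" := (weakly_contained a b) (at level 70, no associativity).

(* Borel isomorphic to a separable complete metric space. *)
Definition standard_borel (R : realType) d (X : measurableType d) :=
  exists M : metricType R,
    [/\ forall F : set_system M, ProperFilter F -> cauchy F ->
          exists l : M, F --> l,
        exists2 D : set M, countable D & dense D &
        exists2 f : X -> M, bijective f &
          forall A : set X, measurable A <-> <<s open >> (f @` A)].

Section Cosets.
Variable Gamma : groupType.
Local Open Scope group_scope.

Definition lcoset (N : set Gamma) (g : Gamma) : set Gamma :=
  [set g * n | n in N].

Record finidx_normal := FinNormal {
  finidx_normal_set :> set Gamma;
  finidx_normal_group : group_closed (mem finidx_normal_set);
  finidx_normal_conj : forall x g, finidx_normal_set x -> finidx_normal_set (x ^ g);
  finidx_normal_index : finite_set (range (lcoset finidx_normal_set))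
}.

Record quot (N : finidx_normal) := Quot {
  quot_set :> set Gamma;
  quot_ex : exists g, quot_set = lcoset N g
}.

HB.instance Definition _ (N : finidx_normal) := gen_eqMixin (quot N).
HB.instance Definition _ (N : finidx_normal) := gen_choiceMixin (quot N).

Variable N : finidx_normal.
Local Notation inN := (finidx_normal_set N).

Lemma quot_inj (A B : quot N) : A = B :> set Gamma -> A = B.
Proof.
by case: A B => [A HA] [B HB] /= AB; subst B; rewrite (Prop_irrelevance HA HB).
Qed.

Lemma finidx_normal1 : inN 1.
Proof. by case: (finidx_normal_group N) => /set_mem. Qed.

Lemma finidx_normalM x y : inN x -> inN y -> inN (x * y).
Proof.
move=> Nx Ny; have /group_closedM NM := finidx_normal_group N.
by apply/set_mem; apply: NM; apply/mem_set.
Qed.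

Lemma finidx_normalV x : inN x -> inN x^-1.
Proof.
move=> Nx; have /group_closedV NV := finidx_normal_group N.
by apply/set_mem; apply: NV; apply/mem_set.
Qed.

Lemma lcosetM g h :
  [set x * y | x in lcoset N g & y in lcoset N h] = lcoset N (g * h).
Proof.
apply/seteqP; split => x /=.
  move=> [y [n Nn <-] [z [m Nm <-] <-]]; exists (n ^ h * m).
    by apply: finidx_normalM => //; apply: finidx_normal_conj.
  by rewrite conjgE !mulgA mulgK.
move=> [n Nn <-]; exists g; first by exists 1; [exact: finidx_normal1|rewrite mulg1].
by exists (h * n); [exists n|rewrite mulgA].
Qed.

Lemma lcosetV g : [set x^-1 | x in lcoset N g] = lcoset N g^-1.
Proof.
apply/seteqP; split => x /=.
  move=> [y [n Nn <-] <-]; exists (n^-1 ^ g^-1).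
    by apply: finidx_normal_conj; apply: finidx_normalV.
  by rewrite conjgE invgK invgM !mulgA mulVg mul1g.
move=> [n Nn <-]; exists (n^-1 * g); last by rewrite invgM invgK.
exists (n^-1 ^ g); first by apply: finidx_normal_conj; apply: finidx_normalV.
by rewrite conjgE !mulgA mulgV mul1g.
Qed.

Definition quot_of (g : Gamma) : quot N := Quot (ex_intro _ g erefl).

Lemma quot_ofP (A : quot N) : exists g, A = quot_of g.
Proof. by case: (quot_ex A) => g Ag; exists g; apply: quot_inj. Qed.

Lemma quot_mul_subproof (A B : quot N) :
  exists g, [set x * y | x in A & y in B] = lcoset N g.
Proof.
have [g ->] := quot_ofP A; have [h ->] := quot_ofP B.
by exists (g * h); exact: lcosetM.
Qed.

Definition quot_mul (A B : quot N) : quot N := Quot (quot_mul_subproof A B).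

Lemma quot_inv_subproof (A : quot N) :
  exists g, [set x^-1 | x in A] = lcoset N g.
Proof. by have [g ->] := quot_ofP A; exists g^-1; exact: lcosetV. Qed.

Definition quot_inv (A : quot N) : quot N := Quot (quot_inv_subproof A).

Lemma quot_ofM g h : quot_mul (quot_of g) (quot_of h) = quot_of (g * h).
Proof. by apply: quot_inj; exact: lcosetM. Qed.

Lemma quot_ofV g : quot_inv (quot_of g) = quot_of g^-1.
Proof. by apply: quot_inj; exact: lcosetV. Qed.

Lemma quot_mulA : associative quot_mul.
Proof.
move=> A B C; have [a ->] := quot_ofP A; have [b ->] := quot_ofP B.
by have [c ->] := quot_ofP C; rewrite !quot_ofM mulgA.
Qed.

Lemma quot_mul1g : left_id (quot_of 1) quot_mul.
Proof. by move=> A; have [a ->] := quot_ofP A; rewrite quot_ofM mul1g. Qed.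

Lemma quot_mulg1 : right_id (quot_of 1) quot_mul.
Proof. by move=> A; have [a ->] := quot_ofP A; rewrite quot_ofM mulg1. Qed.

Lemma quot_mulVg : left_inverse (quot_of 1) quot_inv quot_mul.
Proof. by move=> A; have [a ->] := quot_ofP A; rewrite quot_ofV quot_ofM mulVg. Qed.

Lemma quot_mulgV : right_inverse (quot_of 1) quot_inv quot_mul.
Proof. by move=> A; have [a ->] := quot_ofP A; rewrite quot_ofV quot_ofM mulgV. Qed.

HB.instance Definition _ := isGroup.Build (quot N)
  quot_mulA quot_mul1g quot_mulg1 quot_mulVg quot_mulgV.

End Cosets.

Section Profinite.
Variable Gamma : groupType.
Local Open Scope group_scope.

(* Inverse limit of the finite quotients: for N included in M, the canonical
   map from Gamma / N to Gamma / M sends a coset of N to the coset of M that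
   contains it. *)
Record profinite := Profinite {
  pf_val :> forall N : finidx_normal Gamma, quot N;
  pf_compat : forall N M : finidx_normal Gamma,
    (N : set Gamma) `<=` M -> (pf_val N : set Gamma) `<=` pf_val M
}.

HB.instance Definition _ := gen_eqMixin (finidx_normal Gamma).
HB.instance Definition _ := gen_eqMixin profinite.
HB.instance Definition _ := gen_choiceMixin profinite.

Lemma profinite_inj (x y : profinite) : (forall N, x N = y N) -> x = y.
Proof.
case: x y => [x Hx] [y Hy] /= xy.
have exy : x = y by exact: functional_extensionality_dep.
by subst y; rewrite (Prop_irrelevance Hx Hy).
Qed.

Lemma pf_of_subproof (g : Gamma) (N M : finidx_normal Gamma) :
  (N : set Gamma) `<=` M -> (quot_of N g : set Gamma) `<=` quot_of M g.
Proof. by move=> NM x [n /NM Mn <-]; exists n. Qed.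

Definition pf_of (g : Gamma) : profinite := Profinite (@pf_of_subproof g).

Lemma pf_mul_subproof (x y : profinite) (N M : finidx_normal Gamma) :
  (N : set Gamma) `<=` M -> (x N * y N : set Gamma) `<=` (x M * y M : quot M).
Proof.
move=> NM z [a xa [b yb <-]]; exists a; first exact: pf_compat xa.
by exists b => //; exact: pf_compat yb.
Qed.

Definition pf_mul (x y : profinite) : profinite := Profinite (@pf_mul_subproof x y).

Lemma pf_inv_subproof (x : profinite) (N M : finidx_normal Gamma) :
  (N : set Gamma) `<=` M -> ((x N)^-1 : set Gamma) `<=` ((x M)^-1 : quot M).
Proof. by move=> NM z [a xa <-]; exists a => //; exact: pf_compat xa. Qed.

Definition pf_inv (x : profinite) : profinite := Profinite (@pf_inv_subproof x).

Lemma pf_mulA : associative pf_mul.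
Proof. by move=> x y z; apply: profinite_inj => N /=; exact: mulgA. Qed.

Lemma pf_mul1g : left_id (pf_of 1) pf_mul.
Proof. by move=> x; apply: profinite_inj => N /=; exact: mul1g. Qed.

Lemma pf_mulg1 : right_id (pf_of 1) pf_mul.
Proof. by move=> x; apply: profinite_inj => N /=; exact: mulg1. Qed.

Lemma pf_mulVg : left_inverse (pf_of 1) pf_inv pf_mul.
Proof. by move=> x; apply: profinite_inj => N /=; exact: mulVg. Qed.

Lemma pf_mulgV : right_inverse (pf_of 1) pf_inv pf_mul.
Proof. by move=> x; apply: profinite_inj => N /=; exact: mulgV. Qed.

HB.instance Definition _ := isGroup.Build profinite
  pf_mulA pf_mul1g pf_mulg1 pf_mulVg pf_mulgV.

HB.instance Definition _ := isPointed.Build profinite 1.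

Definition pf_embed (x : profinite) :
  prod_topology (fun N : finidx_normal Gamma => discrete_topology (quot N)) := x.

HB.instance Definition _ :=
  Topological.copy profinite (initial_topology pf_embed).

Lemma pf_ofM g h : pf_of (g * h) = pf_of g * pf_of h.
Proof. by apply: profinite_inj => N; rewrite /= -quot_ofM. Qed.

Lemma pf_proj_continuous (N : finidx_normal Gamma) :
  continuous (fun x : profinite => x N : discrete_topology (quot N)).
Proof.
move=> x; apply: (@continuous_comp _ _ _ pf_embed (proj N)).
  exact: initial_continuous.
exact: proj_continuous.
Qed.

Lemma pf_mul_continuous (h : profinite) :
  continuous (fun x : profinite => h * x).
Proof.
apply: (@continuous_comp_initial _ _ _ pf_embed) => x.
have FF := fmap_filter (pf_embed \o (fun x => h * x)) (nbhs_filter x).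
apply/cvg_sup => N.
have pf_mulN_continuous : continuous
    (fun y : profinite => (h * y) N : discrete_topology (quot N)).
  move=> z; apply/(@discrete_cvg _ _ _ (fmap_filter _ (nbhs_filter z))).
  have Nz := @pf_proj_continuous N z [set z N] (discrete_set1 _).
  by apply: (@filterS _ _ (nbhs_filter z) _ _ _ Nz) => y /= ->.
apply: (@continuous_comp_initial _ _ (discrete_topology (quot N))
  (fun f => f N) (fun x => pf_embed (h * x))).
exact: pf_mulN_continuous.
Qed.

Local Notation profinite_borel := (g_sigma_algebraType (@open profinite)).

Lemma pf_mul_measurable (h : profinite) :
  measurable_fun [set: profinite_borel]
    ((fun x : profinite => h * x) : profinite_borel -> profinite_borel).
Proof.
apply: (@measurability _ _ profinite_borel profinite_borel _ _ (@open profinite)) => //.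
move=> _ [U oU <-]; rewrite setTI; apply: sub_sigma_algebra.
by move/continuousP: (pf_mul_continuous (h := h)); exact.
Qed.

End Profinite.

Notation profinite_borel Gamma := (g_sigma_algebraType (@open (profinite Gamma))).

Section PActions.
Variables (Gamma : groupType) (R : realType).

(* The normalized Haar measure on the Borel sets of the profinite completion,
   a compact group that is metrizable only if Gamma has countably many normal
   subgroups of finite index; regularity is what makes it unique in general. *)
Record haar_measure := HaarMeasure {
  haar :> probability (profinite_borel Gamma) R;
  haar_invariant : forall (h : profinite Gamma) (A : set (profinite_borel Gamma)),
    measurable A -> haar [set (h * x)%g | x in A] = haar A;
  haar_outer_regular : forall A : set (profinite_borel Gamma), measurable A ->
    haar A = ereal_inf [set haar U | U in [set U : set (profinite Gamma) |
                                            open U /\ A `<=` U]];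
  haar_inner_regular : forall U : set (profinite Gamma), open U ->
    haar U = ereal_sup [set haar K | K in [set K : set (profinite Gamma) |
                                            compact K /\ K `<=` U]]
}.

Section p.
Variable m : haar_measure.

Definition p_act (g : Gamma) (x : profinite_borel Gamma) :
  profinite_borel Gamma := (pf_of g * x)%g.

Lemma p_act1 x : p_act 1%g x = x.
Proof. exact: mul1g. Qed.

Lemma p_actM g h x : p_act (g * h)%g x = p_act g (p_act h x).
Proof. by rewrite /p_act pf_ofM mulgA. Qed.

Lemma p_act_measurable g : measurable_fun [set: profinite_borel Gamma] (p_act g).
Proof. exact: pf_mul_measurable. Qed.

Lemma p_act_preserving g (A : set (profinite_borel Gamma)) :
  measurable A -> m (p_act g @^-1` A) = m A.
Proof.
move=> mA; rewrite -(haar_invariant m (pf_of g)).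
  congr (m _); apply/seteqP; split => [_ [x Ax <-] //|x Ax].
  exists ((pf_of g)^-1 * x)%g; last by rewrite mulVKg.
  by rewrite /= /p_act mulVKg.
by rewrite -[X in measurable X]setTI; exact: p_act_measurable.
Qed.

Definition p_action : mp_action Gamma m :=
  MpAction p_act1 p_actM p_act_measurable p_act_preserving.

End p.

(* The unit interval with Lebesgue measure, as a measure on the line: a standard
   non-atomic probability space, unique up to isomorphism. *)
Definition iota_measure : probability (measurableTypeR R) R := uniform_prob (@ltr01 R).

Definition iota_action : mp_action Gamma iota_measure.
Proof.
by exists (fun _ x => x) => // g; exact: measurable_id.
Defined.

Section product.
Context dX dY (X : measurableType dX) (Y : measurableType dY).
Variables (mu : probability X R) (nu : probability Y R).
Variables (a : mp_action Gamma mu) (b : mp_action Gamma nu).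

Definition product_probability : probability (X * Y)%type R := (mu \x nu)%E.

Definition prod_act (g : Gamma) (z : X * Y) : X * Y := (a g z.1, b g z.2).

Lemma prod_act1 z : prod_act 1%g z = z.
Proof. by case: z => x y; rewrite /prod_act !act1. Qed.

Lemma prod_actM g h z : prod_act (g * h)%g z = prod_act g (prod_act h z).
Proof. by rewrite /prod_act !actM. Qed.

Lemma prod_act_measurable g : measurable_fun [set: X * Y] (prod_act g).
Proof.
apply: measurable_fun_pair.
- exact: (measurableT_comp (act_measurable a g) measurable_fst).
- exact: (measurableT_comp (act_measurable b g) measurable_snd).
Qed.

Lemma prod_act_preserving g A :
  measurable A -> product_probability (prod_act g @^-1` A) = product_probability A.
Proof.
move=> mA; apply/esym.
have mpre (dZ : measure_display) (Z : measurableType dZ) (f : Z -> Z) B :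
    measurable_fun [set: Z] f -> measurable B -> measurable (f @^-1` B).
  by move=> mf mB; rewrite -[X in measurable X]setTI; exact: mf.
pose pm := measure_function_pushforward__canonical__measure_function_Measure
  product_probability (prod_act_measurable g).
apply: (@product_measure_unique _ _ _ _ _ mu nu pm) => // B C mB mC.
rewrite /pm /= /pushforward.
have -> : prod_act g @^-1` (B `*` C) = (a g @^-1` B) `*` (b g @^-1` C) by [].
rewrite product_measure1E; [|exact: mpre (act_measurable a g) mB|
  exact: mpre (act_measurable b g) mC].
by congr (_ * _)%E; exact: act_preserving.
Qed.

Definition prod_action : mp_action Gamma product_probability :=
  MpAction prod_act1 prod_actM prod_act_measurable prod_act_preserving.

End product.

(* The Haar measure exists and is unique as a function on Borel sets; [EMD_star]
   and [MD] refer to it by quantifying over m. *)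
Definition EMD_star :=
  forall (m : haar_measure) d (X : measurableType d) (mu : probability X R)
    (b : mp_action Gamma mu),
    standard_borel R X -> ergodic b -> b ≺ p_action m.

Definition MD :=
  forall (m : haar_measure) d (X : measurableType d) (mu : probability X R)
    (b : mp_action Gamma mu),
    standard_borel R X -> b ≺ prod_action iota_action (p_action m).

End PActions.

(* Main.v *)
(* MD implies EMD*: let b be ergodic and weakly contained in iota x p.  Given finitely
   many functions f, the mean ergodic theorem of Alaoglu and Birkhoff (Gamma need
   not be amenable) yields a convex combination T of translations for which the
   averages T f are close in L^2 to the constants int f.  This is a statement about
   finitely many correlations of the translates of a partition, so it passes to a
   partition of iota x p that approximates the given one; by Fubini's theorem it
   holds on some fibre {t} x p, and there the mean of f is within the L^2 error of
   the mean under b, because T preserves means.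

   EMD* implies MD: the correlations of a partition depend only on the shift-invariant
   measure that it induces on the configurations Gamma -> 'I_k.  The set of
   shift-invariant means is compact and convex; minimizing a linear functional and
   then, lexicographically, the masses of all cylinders leads to an extreme point,
   which is an ergodic measure.  Hence no linear functional separates the correlations
   from those of ergodic measures, and the Frank-Wolfe algorithm approximates them by
   averages of correlations of ergodic measures.  Each of these is approximated by a
   partition for p, and the partitions are glued over subintervals of iota. *)

Require Import Defs.
From HB Require Import structures.
From mathcomp Require Import all_boot all_order all_algebra.
From mathcomp Require Import all_classical all_reals all_analysis.
From mathcomp Require Import measurable_realfun ring lra.

Set Implicit Arguments.
Unset Strict Implicit.
Unset Printing Implicit Defensive.

Import Order.TTheory GRing.Theory Num.Theory.
Import numFieldNormedType.Exports.

Local Open Scope ring_scope.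
Local Open Scope classical_set_scope.

(** * Bounded measurable functions and their means *)

Section BoundedFunctions.
Context d (X : measurableType d) (R : realType).
Implicit Types f g : X -> R.

(** Boundedness gives integrability for every probability measure, and the class is closed under
    sums and products, so integrability side conditions need no estimate. *)
Definition bmeas f :=
  measurable_fun [set: X] f /\ exists M : R, forall x, `|f x| <= M.

Lemma bmeas_cst (c : R) : bmeas (fun=> c).
Proof. by split; [exact: measurable_cst|exists `|c|]. Qed.

Lemma bmeasD f g : bmeas f -> bmeas g -> bmeas (fun x => f x + g x).
Proof.
move=> [mf [M fM]] [mg [N gN]]; split; first exact: measurable_funD.
by exists (M + N) => x; rewrite (le_trans (ler_normD _ _))// lerD.
Qed.

Lemma bmeasM f g : bmeas f -> bmeas g -> bmeas (fun x => f x * g x).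
Proof.
move=> [mf [M fM]] [mg [N gN]]; split; first exact: measurable_funM.
by exists (M * N) => x; rewrite normrM ler_pM.
Qed.

Lemma bmeasZ (c : R) f : bmeas f -> bmeas (fun x => c * f x).
Proof. by move=> bf; apply: bmeasM => //; exact: bmeas_cst. Qed.

Lemma bmeasB f g : bmeas f -> bmeas g -> bmeas (fun x => f x - g x).
Proof.
move=> bf bg; apply: bmeasD => //.
by under eq_fun do rewrite -mulN1r; exact: bmeasZ.
Qed.

Lemma bmeas_sqr f : bmeas f -> bmeas (fun x => f x ^+ 2).
Proof. by move=> bf; under eq_fun do rewrite expr2; exact: bmeasM. Qed.

Lemma bmeas_norm f : bmeas f -> bmeas (fun x => `|f x|).
Proof.
move=> [mf [M fM]]; split; first exact: measurableT_comp.
by exists M => x; rewrite normr_id.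
Qed.

Lemma bmeas_sum I (r : seq I) (F : I -> X -> R) :
  (forall i, bmeas (F i)) -> bmeas (fun x => \sum_(i <- r) F i x).
Proof.
move=> bF; elim: r => [|i r IH].
  by under eq_fun do rewrite big_nil; exact: bmeas_cst.
by under eq_fun do rewrite big_cons; exact: bmeasD.
Qed.

Lemma bmeas_comp f (t : X -> X) :
  measurable_fun [set: X] t -> bmeas f -> bmeas (fun x => f (t x)).
Proof.
move=> mt [mf [M fM]]; split; first exact: (measurableT_comp mf mt).
by exists M.
Qed.

Lemma bmeas_indic (A : set X) : measurable A -> bmeas (\1_A).
Proof.
move=> mA; split; first exact: measurable_indic.
exists 1 => x; rewrite indicE.
by case: (_ \in _); rewrite ?normr1 ?normr0.
Qed.

End BoundedFunctions.

Ltac bmeas_tac := repeat first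
  [ assumption | apply: bmeas_cst | apply: bmeasB | apply: bmeasD
  | apply: bmeas_sqr | apply: bmeas_norm | apply: bmeasM ].

Section Expectation.
Context d (X : measurableType d) (R : realType).
Implicit Types f g : X -> R.
Variable P : probability X R.

Lemma bmeas_integrable f : bmeas f -> P.-integrable [set: X] (EFin \o f).
Proof.
move=> [mf [M fM]]; apply: measurable_bounded_integrable => //.
  by rewrite -ge0_fin_numE// fin_num_measure.
exists M; split; first exact: num_real.
by move=> N MN x _ /=; rewrite (le_trans (fM x))// ltW.
Qed.

Definition pr (A : set X) : R := fine (P A).

Lemma prE A : measurable A -> P A = (pr A)%:E.
Proof. by move=> mA; rewrite /pr fineK// fin_num_measure. Qed.

Lemma pr_ge0 A : 0 <= pr A.
Proof. exact: fine_ge0. Qed.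

Lemma prT : pr setT = 1.
Proof. by rewrite /pr probability_setT. Qed.

Lemma pr0 : pr set0 = 0.
Proof. by rewrite /pr measure0. Qed.

Lemma probability_nonempty : [set: X] !=set0.
Proof.
apply/set0P/eqP => X0; have := prT; rewrite X0 pr0 => /eqP.
by rewrite eq_sym oner_eq0.
Qed.

Lemma le_pr A B : measurable A -> measurable B -> A `<=` B -> pr A <= pr B.
Proof.
move=> mA mB AB; rewrite -lee_fin -!prE//.
by apply: le_measure => //; rewrite inE.
Qed.

Lemma pr_le1 A : measurable A -> pr A <= 1.
Proof. by move=> mA; rewrite -prT; apply: le_pr. Qed.

Lemma prU A B : measurable A -> measurable B -> A `&` B = set0 ->
  pr (A `|` B) = pr A + pr B.
Proof.
move=> mA mB AB; apply: EFin_inj; rewrite EFinD -!prE//; last exact: measurableU.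
by rewrite measureU.
Qed.

Lemma pr_leU A B : measurable A -> measurable B -> pr (A `|` B) <= pr A + pr B.
Proof.
move=> mA mB; rewrite -lee_fin EFinD -!prE//; last exact: measurableU.
exact: measureU2.
Qed.

Lemma pr_setC A : measurable A -> pr (~` A) = 1 - pr A.
Proof.
move=> mA; apply/eqP; rewrite eq_sym subr_eq addrC -prU ?setUv ?prT ?setICr//.
exact: measurableC.
Qed.

Lemma prID A B : measurable A -> measurable B ->
  pr A = pr (A `&` B) + pr (A `&` ~` B).
Proof.
move=> mA mB; rewrite -prU; last by rewrite setIACA setICr setI0.
- by rewrite -setIUr setUv setIT.
- exact: measurableI.
- by apply: measurableI => //; exact: measurableC.
Qed.

Lemma pr_bigsetU I (r : seq I) (F : I -> set X) : (forall i, measurable (F i)) ->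
  pr (\big[setU/set0]_(i <- r) F i) <= \sum_(i <- r) pr (F i).
Proof.
move=> mF; elim: r => [|i r IH]; first by rewrite !big_nil pr0.
rewrite !big_cons (le_trans (pr_leU _ _))//; first exact: bigsetU_measurable.
by rewrite lerD2l.
Qed.

Lemma mean_cst (c : R) : \int[P]_x c = c.
Proof. by rewrite Rintegral_cst// -/(pr _) prT mulr1. Qed.

Lemma meanD f g : bmeas f -> bmeas g ->
  \int[P]_x (f x + g x) = \int[P]_x f x + \int[P]_x g x.
Proof. by move=> bf bg; rewrite RintegralD//; exact: bmeas_integrable. Qed.

Lemma meanB f g : bmeas f -> bmeas g ->
  \int[P]_x (f x - g x) = \int[P]_x f x - \int[P]_x g x.
Proof. by move=> bf bg; rewrite RintegralB//; exact: bmeas_integrable. Qed.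

Lemma meanZ c f : bmeas f -> \int[P]_x (c * f x) = c * \int[P]_x f x.
Proof. by move=> bf; rewrite RintegralZl//; exact: bmeas_integrable. Qed.

Lemma mean_sum I (r : seq I) (F : I -> X -> R) : (forall i, bmeas (F i)) ->
  \int[P]_x (\sum_(i <- r) F i x) = \sum_(i <- r) \int[P]_x F i x.
Proof.
move=> bF; elim: r => [|i r IH].
  by under eq_Rintegral do rewrite big_nil; rewrite big_nil mean_cst.
under eq_Rintegral do rewrite big_cons.
by rewrite big_cons meanD ?IH//; exact: bmeas_sum.
Qed.

Lemma le_mean f g : bmeas f -> bmeas g -> (forall x, f x <= g x) ->
  \int[P]_x f x <= \int[P]_x g x.
Proof. by move=> bf bg fg; apply: le_Rintegral => //; exact: bmeas_integrable. Qed.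

Lemma mean_ge0 f : (forall x, 0 <= f x) -> 0 <= \int[P]_x f x.
Proof. by move=> f0; exact: Rintegral_ge0. Qed.

Lemma norm_mean_le f : bmeas f -> `|\int[P]_x f x| <= \int[P]_x `|f x|.
Proof. by move=> bf; apply: le_normr_Rintegral => //; exact: bmeas_integrable. Qed.

Lemma mean_indic A : measurable A -> \int[P]_x \1_A x = pr A.
Proof.
by move=> mA; rewrite /Rintegral integral_indic// setIT.
Qed.

Lemma mean_EFin f : bmeas f -> (\int[P]_x (f x)%:E)%E = (\int[P]_x f x)%:E.
Proof.
by move=> /bmeas_integrable/(integrable_fin_num measurableT) ?; rewrite fineK.
Qed.

(** Jensen's inequality for the square: its tangent line at the mean is integrated. *)
Lemma sqr_mean_le f : bmeas f -> forall c,
  (\int[P]_x f x - c) ^+ 2 <= \int[P]_x (f x - c) ^+ 2.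
Proof.
move=> bf c; set m := \int[P]_x f x.
have bfc : bmeas (fun x => f x - c) by apply: bmeasB => //; exact: bmeas_cst.
have -> : (m - c) ^+ 2 = \int[P]_x (2 * (m - c) * (f x - c) - (m - c) ^+ 2).
  rewrite meanB ?meanZ ?meanB ?mean_cst//; [by rewrite -/m; ring|bmeas_tac..].
apply: le_mean => [||x]; [bmeas_tac..|].
by rewrite -subr_ge0; have := sqr_ge0 (f x - m); nra.
Qed.

(** In place of Cauchy-Schwarz, the pointwise bound [|f| <= f^2 / (2 e) + e / 2] is integrated. *)
Lemma mean_norm_le f (e : R) : bmeas f -> 0 < e ->
  \int[P]_x f x ^+ 2 <= e ^+ 2 -> \int[P]_x `|f x| <= e.
Proof.
move=> bf e0 fe.
have h : \int[P]_x `|f x| <= \int[P]_x (e^-1 * 2^-1 * (f x ^+ 2) + e / 2).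
  apply: le_mean => [||x]; [bmeas_tac..|].
  rewrite -(ler_pM2l (x := 2 * e)) ?mulr_gt0//.
  have -> : 2 * e * (e^-1 * 2^-1 * f x ^+ 2 + e / 2) = f x ^+ 2 + e ^+ 2.
    by field; rewrite gt_eqF.
  by rewrite -(real_normK (num_real (f x))); have := sqr_ge0 (`|f x| - e); nra.
apply: (le_trans h).
rewrite meanD ?meanZ ?mean_cst; [|bmeas_tac..].
rewrite -[leRHS](_ : e^-1 * 2^-1 * e ^+ 2 + e / 2 = e); last first.
  by field; rewrite gt_eqF.
by rewrite lerD2r ler_wpM2l// mulr_ge0// invr_ge0 ltW.
Qed.

End Expectation.

(** * Rapidly Cauchy sequences in L^1 *)

(** The upper limit of a bounded sequence always exists, so it serves below as a limit function
    defined at every point; only a tail of the sequence has to obey the bounds. *)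
Lemma limn_sup_bounds (R : realType) (u : R^nat) n (a b : R) : bounded_fun u ->
  (forall j, (n <= j)%N -> a <= u j <= b) -> a <= limn_sup u <= b.
Proof.
move=> bu uab; rewrite limn_supE//.
have ubu := bounded_fun_has_ubound bu.
have lbs : has_lbound (range (sups u)) by exact: bounded_fun_has_lbound_sups.
have sdrop_ub m : has_ubound (sdrop u m).
  by move: ubu => [M uM]; exists M => _ [k _ <-]; apply: uM; exists k.
apply/andP; split.
  apply: lb_le_inf; first by exists (sups u 0%N); exists 0%N.
  move=> _ [m _ <-]; have /andP[/le_trans + _] := uab (maxn m n) (leq_maxr _ _).
  apply; apply: ub_le_sup; first exact: sdrop_ub.
  by exists (maxn m n) => //=; exact: leq_maxl.
apply: (le_trans (ge_inf lbs _)); first by exists n.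
apply: ge_sup; first by exists (u n), n => /=.
by move=> _ [m /= nm <-]; have /andP[] := uab _ nm.
Qed.

Section L1Limit.
Context d (X : measurableType d) (R : realType) (P : probability X R).

Lemma measurable_neqr (f g : X -> R) : measurable_fun [set: X] f ->
  measurable_fun [set: X] g -> measurable [set x | f x != g x].
Proof.
move=> mf mg; rewrite -[X in measurable X]setTI.
rewrite (_ : [set x | _] = [set x | (f x - g x)%:E != 0%:E]); last first.
  by apply/seteqP; split => x; rewrite /= eqe subr_eq0.
apply: emeasurable_neq => //; apply/measurable_EFinP; exact: measurable_funB.
Qed.

Lemma mean_norm0_ae (f : X -> R) : bmeas f -> \int[P]_x `|f x| = 0 ->
  P [set x | f x != 0] = 0%E.
Proof.
move=> bf f0.
have mf : measurable_fun [set: X] (EFin \o f).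
  by apply/measurable_EFinP; case: bf.
have : (\int[P]_x `|(EFin \o f) x|)%E = 0%E.
  rewrite -[RHS](_ : (\int[P]_x `|f x|)%:E = 0%E); last by rewrite f0.
  by rewrite -mean_EFin//; exact: bmeas_norm.
move/(ae_eq_integral_abs P measurableT mf) => [N [mN N0 sub]].
apply/eqP; rewrite -measure_le0 -N0 le_measure ?inE//.
  by apply: measurable_neqr => //; case: bf.
by move=> x /= fx; apply: sub => /= /(_ I) [] /eqP; rewrite (negbTE fx).
Qed.

Lemma mean_ae_eq (f g : X -> R) : bmeas f -> bmeas g ->
  P [set x | f x != g x] = 0%E -> \int[P]_x f x = \int[P]_x g x.
Proof.
move=> [mf _] [mg _] fg; congr fine.
apply: ae_eq_integral => //; [exact/measurable_EFinP|exact/measurable_EFinP|].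
exists [set x | f x != g x]; split => //.
  exact: measurable_neqr.
by move=> x /= /not_implyP[_ /eqP]; rewrite eqe.
Qed.

(** Completeness of L^1 with an explicit rate: the norms of the increments are dominated by a
    telescoping series, and the pointwise upper limit is the limit. *)
Lemma L1_cauchy_limit (u : nat -> X -> R) (b : R^nat) :
  (forall n, measurable_fun [set: X] (u n)) -> (forall n x, `|u n x| <= 1) ->
  (forall n, 0 <= b n) ->
  (forall n, \int[P]_x `|u n.+1 x - u n x| <= b n - b n.+1) ->
  exists2 h, bmeas h & forall n, \int[P]_x `|u n x - h x| <= b n.
Proof.
move=> mu u1 b0 ub.
have bu n : bmeas (u n) by split => //; exists 1.
pose D n x := `|u n.+1 x - u n x|.
have bD n : bmeas (D n) by bmeas_tac.
have bfu x : bounded_fun (u ^~ x).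
  exists 1; split; first exact: num_real.
  by move=> M M1 n _ /=; rewrite (le_trans (u1 n x))// ltW.
pose h x := limn_sup (u ^~ x).
have h1 x : `|h x| <= 1.
  rewrite ler_norml; apply: (@limn_sup_bounds _ _ 0%N) => // j _.
  by rewrite -ler_norml.
have mh : measurable_fun [set: X] h.
  apply: measurable_fun_limn_sup => // x _.
    exact: bounded_fun_has_ubound.
  exact: bounded_fun_has_lbound.
have bh : bmeas h by split => //; exists 1.
exists h => // n.
(* Where the series of increments diverges the bound is trivial, so no exceptional null set has to
   be removed. *)
have ptw x : (`|u n x - h x|%:E <= \sum_(k <oo) (D (n + k)%N x)%:E)%E.
  have D0 k : (0 <= (D (n + k)%N x)%:E)%E by rewrite lee_fin normr_ge0.
  case: (leP +oo%E (\sum_(k <oo) (D (n + k)%N x)%:E)%E) => [/(le_trans (leey _))//|].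
  have S0 : (0 <= \sum_(k <oo) (D (n + k)%N x)%:E)%E by apply: nneseries_ge0.
  rewrite -ge0_fin_numE// => Sfin.
  rewrite -(fineK Sfin) lee_fin; set s := fine _.
  have part m : \sum_(0 <= k < m) D (n + k)%N x <= s.
    rewrite -lee_fin fineK// -sumEFin.
    by apply: nneseries_lim_ge => k _ _; exact: D0.
  have ujn j : `|u (n + j)%N x - u n x| <= s.
    apply: le_trans (part j); elim: j => [|j IH].
      by rewrite addn0 subrr normr0 big_geq.
    rewrite big_nat_recr//= addnS.
    rewrite -[_ - u n x](subrKA (u (n + j)%N x)) addrC.
    by rewrite (le_trans (ler_normD _ _))// lerD.
  rewrite distrC ler_distl; apply: (@limn_sup_bounds _ _ n) => // j nj.
  by rewrite -ler_distl -(subnKC nj).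
rewrite -lee_fin -mean_EFin; last by bmeas_tac.
apply: (@le_trans _ _ (\int[P]_x \sum_(k <oo) (D (n + k)%N x)%:E)%E).
  apply: ge0_le_integral => //.
  - by apply/measurable_EFinP; have [] : bmeas (fun x => `|u n x - h x|) by bmeas_tac.
  - apply: ge0_emeasurable_sum => [k x _ _|k _]; first by rewrite lee_fin normr_ge0.
    by apply/measurable_EFinP; case: (bD (n + k)%N).
rewrite integral_nneseries//; first last.
- by move=> k x _; rewrite lee_fin normr_ge0.
- by move=> k; apply/measurable_EFinP; case: (bD (n + k)%N).
apply: lime_le.
  apply: is_cvg_nneseries => k _ _; apply: integral_ge0 => x _.
  by rewrite lee_fin normr_ge0.
apply: nearW => m.
under eq_bigr do rewrite mean_EFin//.
rewrite sumEFin lee_fin (@le_trans _ _ (b n - b (n + m)%N))//; last by rewrite gerBl.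
elim: m => [|m IH]; first by rewrite big_geq// addn0 subrr.
rewrite big_nat_recr//= addnS; have := ub (n + m)%N; rewrite /D; lra.
Qed.

End L1Limit.

(** * Convex combinations of translations *)

Section Enumeration.
Variable Gamma : groupType.

Lemma countable_enum : countable [set: Gamma] ->
  exists e : nat -> Gamma, forall g, exists n, e n = g.
Proof.
move=> /pfcard_geP[/seteqP[/(_ 1%g I)//]|[f]].
exists f => g; by have [n _ <-] := @surj _ _ _ _ f g I; exists n.
Qed.

End Enumeration.

Section ActionBasics.
Context (Gamma : groupType) (R : realType) d (X : measurableType d).
Variables (mu : probability X R) (a : mp_action Gamma mu).

Lemma actK g x : a g^-1%g (a g x) = x.
Proof. by rewrite -actM mulVg act1. Qed.

Lemma actKV g x : a g (a g^-1%g x) = x.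
Proof. by rewrite -actM mulgV act1. Qed.

Lemma act_image g A : a g @` A = a g^-1%g @^-1` A.
Proof.
apply/seteqP; split => [_ [x Ax <-]|x Ax]; first by rewrite /= actK.
by exists (a g^-1%g x) => //; rewrite actKV.
Qed.

Lemma measurable_act_preimage g A : measurable A -> measurable (a g @^-1` A).
Proof. by move=> mA; rewrite -[X in measurable X]setTI; exact: act_measurable. Qed.

Lemma pr_act_preimage g A : measurable A -> pr mu (a g @^-1` A) = pr mu A.
Proof. by move=> mA; rewrite /pr act_preserving. Qed.

Lemma bmeas_act g (f : X -> R) : bmeas f -> bmeas (fun x => f (a g x)).
Proof. by apply: bmeas_comp; exact: act_measurable. Qed.

Lemma mean_act g (f : X -> R) : bmeas f -> \int[mu]_x f (a g x) = \int[mu]_x f x.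
Proof.
move=> bf; rewrite /Rintegral; congr fine.
have mg := act_measurable a g.
have := @integral_pushforward _ _ _ _ R _ mg mu setT (EFin \o f).
rewrite preimage_setT => <- //; last 2 first.
- by apply/measurable_EFinP; case: bf.
- exact/bmeas_integrable/bmeas_act.
apply: eq_measure_integral => A mA _; rewrite /= /pushforward.
exact: act_preserving.
Qed.

(** Ergodicity speaks of strictly invariant sets. The intersection of all preimages of [A] is
    strictly invariant, and by countability it differs from [A] by a null set. *)
Lemma ergodic_almost_invariant (A : set X) : countable [set: Gamma] ->
  ergodic a -> measurable A -> (forall g, mu (A `\` a g @^-1` A) = 0%E) ->
  mu A = 0%E \/ mu A = 1%E.
Proof.
move=> /countable_enum[e esurj] erg mA Ainv.
pose B := \bigcap_n a (e n) @^-1` A.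
have mB : measurable B.
  by apply: bigcapT_measurable => n; exact: measurable_act_preimage.
have BA : B `<=` A.
  by move=> x Bx; have [n en] := esurj 1%g; have := Bx n I; rewrite en /= act1.
have Bpre g : a g @^-1` B `<=` B.
  move=> x Bx n _; have [m em] := esurj (e n * g^-1)%g.
  by have := Bx m I; rewrite /= em actM actK.
have Binv g : a g @` B = B.
  rewrite act_image; apply/seteqP; split; first exact: Bpre.
  by move=> x Bx; apply: (Bpre g); rewrite /= actKV.
have AB : mu (A `\` B) = 0%E.
  apply/negligibleP; first exact: measurableD.
  rewrite /B setDE setC_bigcap setI_bigcupr.
  apply: negligible_bigcup => n; apply/negligibleP.
    by apply: measurableD => //; exact: measurable_act_preimage.
  exact: Ainv.
suff -> : mu A = mu B by exact: erg.
have -> : mu A = (mu B + mu (A `\` B))%E; last by rewrite AB adde0.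
by rewrite -measureU ?setDUK ?setDIK//; exact: measurableD.
Qed.

Implicit Types (T : seq (R * Gamma)) (f : X -> R).

(** A finite combination of translations is kept as a list of weighted group elements, so that one
    and the same [T] can be applied in different actions. *)
Definition avg T f (x : X) : R := \sum_(p <- T) p.1 * f (a p.2 x).

Definition convex_weights T :=
  \sum_(p <- T) p.1 = 1 /\ forall p, p \in T -> 0 <= p.1.

Lemma bmeas_avg T f : bmeas f -> bmeas (avg T f).
Proof.
move=> bf; apply: (@bmeas_sum _ _ _ _ T (fun p x => p.1 * f (a p.2 x))) => p.
exact/bmeasZ/bmeas_act.
Qed.

Lemma mean_avg T f : convex_weights T -> bmeas f ->
  \int[mu]_x avg T f x = \int[mu]_x f x.
Proof.
move=> [T1 _] bf; rewrite mean_sum; last first.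
  by move=> p; apply: bmeasZ; exact: bmeas_act.
rewrite (eq_bigr (fun p => p.1 * \int[mu]_x f x)) => [|p _].
  by rewrite -mulr_suml T1 mul1r.
by rewrite meanZ ?mean_act//; exact: bmeas_act.
Qed.

Lemma avg_bound T f x : convex_weights T -> (forall y, `|f y| <= 1) ->
  `|avg T f x| <= 1.
Proof.
move=> [T1 T0] f1; rewrite (le_trans (ler_norm_sum _ _ _))// -T1.
rewrite big_seq [leRHS]big_seq; apply: ler_sum => p /T0 p0.
by rewrite normrM ger0_norm// ler_piMr.
Qed.

Definition midpoint T1 T2 : seq (R * Gamma) :=
  [seq (p.1 / 2, p.2) | p <- T1 ++ T2].

Lemma avg_midpoint T1 T2 f x :
  avg (midpoint T1 T2) f x = (avg T1 f x + avg T2 f x) / 2.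
Proof.
rewrite /avg /midpoint big_map /= -big_cat mulr_suml.
by apply: eq_bigr => p _; rewrite mulrAC.
Qed.

Lemma convex_midpoint T1 T2 :
  convex_weights T1 -> convex_weights T2 -> convex_weights (midpoint T1 T2).
Proof.
move=> [T11 T10] [T21 T20]; split.
  by rewrite /midpoint big_map -mulr_suml big_cat/= T11 T21; lra.
move=> _ /mapP[p + ->] /=; rewrite mem_cat => /orP[/T10|/T20] p0;
  by rewrite divr_ge0.
Qed.

Definition translate T (g : Gamma) : seq (R * Gamma) :=
  [seq (p.1, (p.2 * g)%g) | p <- T].

Lemma avg_translate T g f x : avg (translate T g) f x = avg T f (a g x).
Proof.
by rewrite /avg /translate big_map; apply: eq_bigr => p _; rewrite /= actM.
Qed.

Lemma convex_translate T g : convex_weights T -> convex_weights (translate T g).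
Proof.
move=> [T1 T0]; split; first by rewrite /translate big_map.
by move=> _ /mapP[p /T0 + ->].
Qed.

End ActionBasics.

(** * The mean ergodic theorem *)

Section MeanErgodic.
Context (Gamma : groupType) (R : realType) d (X : measurableType d).
Variables (mu : probability X R) (a : mp_action Gamma mu).
Variables (I : finType) (f : I -> X -> R).
Hypothesis mf : forall i, measurable_fun [set: X] (f i).
Hypothesis f1 : forall i x, `|f i x| <= 1.

Let bf i : bmeas (f i). Proof. by split => //; exists 1. Qed.

Let bavg T i : bmeas (avg a T (f i)). Proof. exact: bmeas_avg. Qed.

(** The squared L^2 norms are summed over the whole family because a single [T] has to serve all the
    functions at once. *)
Let N T : R := \int[mu]_x \sum_i avg a T (f i) x ^+ 2.

Let bN T : bmeas (fun x => \sum_i avg a T (f i) x ^+ 2).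
Proof. by apply: bmeas_sum => i; exact: bmeas_sqr. Qed.

Let E := [set N T | T in @convex_weights Gamma R].

Let infE : has_inf E.
Proof.
split; last first.
  exists 0 => _ [T _ <-]; apply: mean_ge0 => x.
  by apply: sumr_ge0 => i _; exact: sqr_ge0.
exists (N [:: (1, 1%g)]); exists [:: (1, 1%g)] => //.
split; first by rewrite big_seq1.
by move=> p; rewrite inE => /eqP ->.
Qed.

Let le_infE T : convex_weights T -> inf E <= N T.
Proof. by move=> cT; apply: ge_inf; [case: infE|exists T]. Qed.

(* By the parallelogram identity, as the midpoint of T1 and T2 is convex too. *)
Let avg_dist T1 T2 i : convex_weights T1 -> convex_weights T2 ->
  \int[mu]_x (avg a T1 (f i) x - avg a T2 (f i) x) ^+ 2 <=
  2 * (N T1 - inf E) + 2 * (N T2 - inf E).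
Proof.
move=> c1 c2; have /le_infE := convex_midpoint c1 c2.
set T := midpoint T1 T2 => infT.
apply: (@le_trans _ _ (2 * N T1 + 2 * N T2 - 4 * N T)); last by lra.
rewrite /N -!meanZ// -meanD; [|by bmeas_tac..].
rewrite -meanB; [|by bmeas_tac..].
apply: le_mean => [||x]; [by bmeas_tac..|].
rewrite !mulr_sumr -big_split/= -sumrB (bigD1 i)//= avg_midpoint.
rewrite -[leLHS]addr0 lerD//.
  by rewrite le_eqVlt; apply/orP; left; apply/eqP; field.
apply: sumr_ge0 => j _; rewrite avg_midpoint.
by have := sqr_ge0 (avg a T1 (f j) x - avg a T2 (f j) x); lra.
Qed.

Let delta n : R := 4^-1 ^+ n.

Let delta_gt0 n : 0 < delta n.
Proof. by rewrite exprn_gt0. Qed.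

Let deltaS n : delta n.+1 = delta n / 4.
Proof. by rewrite /delta exprSr. Qed.

Let delta_small (e : R) : 0 < e -> exists n, delta n <= e.
Proof.
move=> e0; exists (Num.bound e^-1); rewrite /delta exprVn invf_ple ?posrE//.
rewrite (le_trans (ltW (archi_boundP _)))//; first by rewrite invr_ge0 ltW.
by rewrite -natrX ler_nat ltnW// ltn_expl.
Qed.

Let minseq : {T : nat -> seq (R * Gamma) |
  forall n, convex_weights (T n) /\ N (T n) <= inf E + delta n ^+ 2}.
Proof.
have /choice[T cT] : forall n, exists T,
    convex_weights T /\ N T <= inf E + delta n ^+ 2; last by exists T.
move=> n.
have [_ [T cT <-] NT] := inf_adherent (exprn_gt0 2 (delta_gt0 n)) infE.
by exists T; split => //; exact: ltW.
Qed.

Let T := sval minseq.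

Let cT n : convex_weights (T n). Proof. by have [] := svalP minseq n. Qed.

Let NT n : N (T n) <= inf E + delta n ^+ 2. Proof. by have [] := svalP minseq n. Qed.

Let T_cauchy i n :
  \int[mu]_x `|avg a (T n.+1) (f i) x - avg a (T n) (f i) x| <= 2 * delta n.
Proof.
apply: mean_norm_le; [by bmeas_tac|by rewrite mulr_gt0|].
have := avg_dist i (cT n.+1) (cT n); have := NT n; have := NT n.+1.
rewrite deltaS; have := sqr_ge0 (delta n); set t := delta n; set I1 := \int[_]_x _.
rewrite !exprMn; move: (t ^+ 2) => s; lra.
Qed.

(** Translating [T n] leaves [N] unchanged, as the action preserves the measure, and two
    near-minimizers are close by [avg_dist]. *)
Let T_invariant i n g :
  \int[mu]_x `|avg a (T n) (f i) (a g x) - avg a (T n) (f i) x| <= 2 * delta n.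
Proof.
apply: mean_norm_le.
- by apply: bmeasB => //; exact: (bmeas_act a g (bavg _ _)).
- by rewrite mulr_gt0.
have cTg := convex_translate g (cT n).
have NTg : N (translate (T n) g) = N (T n).
  rewrite /N -(mean_act a g (bN (T n))); apply: eq_Rintegral => x _.
  by apply: eq_bigr => j _; rewrite avg_translate.
have := avg_dist i cTg (cT n); rewrite NTg; under eq_Rintegral do rewrite avg_translate.
have := NT n; set t := delta n; set I1 := \int[_]_x _.
rewrite exprMn; move: (t ^+ 2) => s; lra.
Qed.

Let limit i : exists2 h, bmeas h &
  forall n, \int[mu]_x `|avg a (T n) (f i) x - h x| <= 4 * delta n.
Proof.
apply: L1_cauchy_limit => [n|n x|n|n].
- by case: (bavg (T n) i).
- exact: avg_bound.
- by rewrite mulr_ge0// ltW.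
(* With [b n = 4 * delta n] the decrement is [3 * delta n], enough to cover [2 * delta n]. *)
- apply: (le_trans (T_cauchy i n)); rewrite deltaS; have := delta_gt0 n; lra.
Qed.

Let limit_mean i h : bmeas h ->
  (forall n, \int[mu]_x `|avg a (T n) (f i) x - h x| <= 4 * delta n) ->
  \int[mu]_x h x = \int[mu]_x f i x.
Proof.
move=> bh uh; apply/eqP; rewrite -subr_eq0 -normr_eq0 eq_le normr_ge0 andbT.
apply/ler_addgt0Pr => e e0; rewrite add0r.
have [n dn] := delta_small (divr_gt0 e0 (ltr0n R 4)).
rewrite distrC -(mean_avg a (cT n) (bf i)) -meanB//.
rewrite (le_trans (norm_mean_le mu _))//; first by bmeas_tac.
by rewrite (le_trans (uh n))//; lra.
Qed.

Let limit_invariant i h g : bmeas h ->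
  (forall n, \int[mu]_x `|avg a (T n) (f i) x - h x| <= 4 * delta n) ->
  mu [set x | h (a g x) - h x != 0] = 0%E.
Proof.
move=> bh uh.
have bhg : bmeas (fun x => h (a g x)) by exact: bmeas_act.
apply: (@mean_norm0_ae _ _ _ _ (fun x => h (a g x) - h x)); first by bmeas_tac.
apply/eqP; rewrite eq_le mean_ge0// andbT.
apply/ler_addgt0Pr => e e0; rewrite add0r.
(* The three terms of the triangle inequality below cost 4, 2 and 4 times [delta n]. *)
have [n dn] := delta_small (divr_gt0 e0 (ltr0n R 10)).
pose u := avg a (T n) (f i).
have bu : bmeas u by exact: bavg.
have bug : bmeas (fun x => u (a g x)) by exact: bmeas_act.
have le1 := uh n; have le2 := T_invariant i n g.
have le3 : \int[mu]_x `|u (a g x) - h (a g x)| <= 4 * delta n.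
  by rewrite (@mean_act _ _ _ _ _ a g (fun x => `|u x - h x|))//; bmeas_tac.
apply: (@le_trans _ _ (\int[mu]_x
    (`|u x - h x| + `|u (a g x) - u x| + `|u (a g x) - h (a g x)|))).
  apply: le_mean => [||x]; [by bmeas_tac..|].
  have <- : (u x - h x) + (u (a g x) - u x) - (u (a g x) - h (a g x)) =
    h (a g x) - h x by ring.
  by rewrite (le_trans (ler_normB _ _))// lerD2r ler_normD.
rewrite !meanD; [|by bmeas_tac..].
by move: le1 le2 le3; rewrite -/u; lra.
Qed.

(* Alaoglu and Birkhoff: the element of least norm in the closed convex hull of
   an orbit is invariant, hence constant. *)
Theorem mean_ergodic (e : R) : countable [set: Gamma] -> ergodic a -> 0 < e ->
  exists2 T, convex_weights T & forall i,
    \int[mu]_x (avg a T (f i) x - \int[mu]_y f i y) ^+ 2 <= e.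
Proof.
move=> cGamma erg e0.
(* The factor 8 is the 4 of the L^1 rate times the bound 2 on [|u - c|], by which the square is
   reduced to the absolute value at the end. *)
have [n dn] := delta_small (divr_gt0 e0 (ltr0n R 8)).
exists (T n) => // i; set c := \int[mu]_y f i y.
have [h bh uh] := limit i.
have hc : \int[mu]_x h x = c by exact: limit_mean uh.
have bc : bmeas (fun _ : X => c) by exact: bmeas_cst.
have mA : measurable [set x | c < h x].
  rewrite -[X in measurable X]setTI; case: bh => mh _.
  by have := mh measurableT `]c, +oo[%classic (measurable_itv _);
    rewrite preimage_itvoy.
(* The set where [h] exceeds its mean [c] is almost invariant, hence null or of full measure. Either
   way [h - c] has a constant sign almost everywhere, and its mean is zero. *)
have h_cst : \int[mu]_x `|h x - c| = 0.
  have [A0|A1] : mu [set x | c < h x] = 0%E \/ mu [set x | c < h x] = 1%E.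
  - apply: (ergodic_almost_invariant cGamma erg mA) => g.
    have hg0 := limit_invariant g bh uh.
    apply: (@subset_measure0 _ _ _ mu _ _ _ _ _ hg0).
    + by apply: measurableD => //; exact: measurable_act_preimage.
    + apply: (@measurable_neqr _ _ R (fun x => h (a g x) - h x) (cst 0)) => //.
      have [//] : bmeas (fun x => h (a g x) - h x).
      by apply: bmeasB => //; exact: bmeas_act.
    + move=> x /= [chx chgx]; apply/eqP => /subr0_eq hgx; apply: chgx.
      by rewrite hgx.
  - rewrite -[RHS](_ : \int[mu]_x (c - h x) = 0); last first.
      by rewrite meanB// mean_cst hc subrr.
    apply: mean_ae_eq; [by bmeas_tac..|].
    apply: (@subset_measure0 _ _ _ mu _ _ _ _ _ A0) => //.
      apply: measurable_neqr; first by have [] : bmeas (fun x => `|h x - c|) by bmeas_tac.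
      by have [] : bmeas (fun x => c - h x) by bmeas_tac.
    move=> x /=; apply: contraNT; rewrite -leNgt => hxc.
    by apply/eqP; rewrite distrC ger0_norm// subr_ge0.
  - rewrite -[RHS](_ : \int[mu]_x (h x - c) = 0); last first.
      by rewrite meanB// mean_cst hc subrr.
    have A1' : mu (~` [set x | c < h x]) = 0%E.
      by rewrite prE ?pr_setC /pr ?A1 ?subrr//; exact: measurableC.
    apply: mean_ae_eq; [by bmeas_tac..|].
    apply: (@subset_measure0 _ _ _ mu _ _ _ _ _ A1') => //.
    + apply: measurable_neqr; first by have [] : bmeas (fun x => `|h x - c|) by bmeas_tac.
      by have [] : bmeas (fun x => h x - c) by bmeas_tac.
    + exact: measurableC.
    + move=> x /=; move=> /eqP neq chx; apply: neq.
      by rewrite ger0_norm// subr_ge0 ltW.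
have c1 : `|c| <= 1.
  rewrite (le_trans (norm_mean_le mu (bf i)))// -(mean_cst mu 1).
  by apply: le_mean => //; [exact: bmeas_norm|exact: bmeas_cst].
pose u := avg a (T n) (f i).
have bu : bmeas u by exact: bavg.
apply: (@le_trans _ _ (\int[mu]_x (2 * (`|u x - h x| + `|h x - c|)))); last first.
  rewrite meanZ ?meanD; [|by bmeas_tac..].
  by rewrite h_cst addr0; have := uh n; rewrite -/u; lra.
apply: le_mean => [||x]; [by bmeas_tac..|].
rewrite -(real_normK (num_real (_ - c))) expr2 ler_pM//.
  rewrite (le_trans (ler_normB _ _))// (_ : 2 = 1 + 1)// lerD//.
  exact: avg_bound.
by rewrite -(subrKA (h x)) ler_normD.
Qed.

End MeanErgodic.

(** * Labelings and configurations *)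

Section Labelings.
Context d (X : measurableType d) (R : realType) (P : probability X R).
Implicit Types L U : finType.

(** A partition with possibly empty pieces amounts to a function to the index type; in this form
    joint refinements are pairs and coarsenings are compositions. *)
Definition measurable_labeling L (al : X -> L) :=
  forall i, measurable (al @^-1` [set i]).

Lemma labeling_preimage L (al : X -> L) (A : set L) :
  measurable_labeling al -> measurable (al @^-1` A).
Proof.
move=> mal; rewrite (_ : _ @^-1` _ = \bigcup_(i in A) al @^-1` [set i]).
  by apply: fin_bigcup_measurable => // i _; exact: mal.
by apply/seteqP; split => [x Ax|x [i Ai /= ->] //]; exists (al x).
Qed.

Lemma labeling_comp L U (al : X -> L) (h : L -> U) :
  measurable_labeling al -> measurable_labeling (h \o al).
Proof. by move=> mal i; exact: (labeling_preimage (h @^-1` [set i])). Qed.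

Lemma labeling_pair L U (al : X -> L) (be : X -> U) :
  measurable_labeling al -> measurable_labeling be ->
  measurable_labeling (fun x => (al x, be x)).
Proof.
move=> mal mbe [i j].
rewrite (_ : _ @^-1` _ = al @^-1` [set i] `&` be @^-1` [set j]).
  exact: measurableI.
by apply/seteqP; split => x /= [-> ->].
Qed.

Lemma partition_labeling k (B : 'I_k -> set X) : measurable_partition B ->
  exists2 be : X -> 'I_k, measurable_labeling be &
    forall i, B i = be @^-1` [set i].
Proof.
move=> [mB tB cB].
have /choice[be beP] : forall x, exists i, B i x.
  by move=> x; have [i _ Bi] : (\bigcup_i B i) x; [rewrite cB|exists i].
have BE i : B i = be @^-1` [set i].
  apply/seteqP; split => [x Bix|x /= <-]; last exact: beP.
  by apply: (tB (be x) i) => //; exists x.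
by exists be => // i; rewrite -BE.
Qed.

Lemma labeling_partition k (be : X -> 'I_k) : measurable_labeling be ->
  measurable_partition (fun i => be @^-1` [set i]).
Proof.
move=> mbe; split => //.
- apply/trivIsetP => i j _ _ /eqP ij; apply/seteqP; split => // x /= [bi bj].
  by apply: ij; rewrite -bi -bj.
- by apply/seteqP; split => // x _; exists (be x).
Qed.

Lemma bmeas_labeling L (al : X -> L) (Psi : L -> R) : measurable_labeling al ->
  bmeas (fun x => Psi (al x)).
Proof.
move=> mal; split.
  by move=> _ B mB; rewrite setTI; exact: (labeling_preimage (Psi @^-1` B)).
exists (\sum_i `|Psi i|) => x; rewrite (bigD1 (al x))//= lerDl.
exact: sumr_ge0.
Qed.

Lemma mean_labeling L (al : X -> L) (Psi : L -> R) : measurable_labeling al ->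
  \int[P]_x Psi (al x) = \sum_i Psi i * pr P (al @^-1` [set i]).
Proof.
move=> mal; transitivity (\int[P]_x \sum_i Psi i * \1_(al @^-1` [set i]) x).
  apply: eq_Rintegral => x _; rewrite (bigD1 (al x))//= big1 => [|i ilx].
    by rewrite addr0 indicE mem_set// mulr1.
  by rewrite indicE memNset ?mulr0//= => /eqP; rewrite eq_sym (negbTE ilx).
rewrite mean_sum => [|i]; last exact/bmeasZ/bmeas_indic/mal.
by apply: eq_bigr => i _; rewrite meanZ ?mean_indic//; exact/bmeas_indic/mal.
Qed.

Lemma pr_bigcup_fin (I : finType) (F : I -> set X) (e : R) (S : set X) :
  measurable S -> (forall i, measurable (F i)) -> (forall i, pr P (F i) <= e) ->
  S `<=` \bigcup_i F i -> pr P S <= #|I|%:R * e.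
Proof.
move=> mS mF Fe SF.
have FE : \bigcup_i F i = \big[setU/set0]_(i <- enum I) F i.
  rewrite -bigcup_seq; apply/seteqP; split => x [i _ Fx]; exists i => //=.
  by rewrite mem_enum.
have mU : measurable (\big[setU/set0]_(i <- enum I) F i).
  exact: bigsetU_measurable.
rewrite (le_trans (le_pr _ _ _ SF))//; first by rewrite FE.
rewrite FE (le_trans (pr_bigsetU _ _ _))// big_enum/=.
by rewrite (le_trans (ler_sum _ (fun i _ => Fe i)))// sumr_const mulr_natl.
Qed.

End Labelings.

Section Configurations.
Context (Gamma : groupType) (R : realType) d (X : measurableType d).
Variables (mu : probability X R) (a : mp_action Gamma mu) (L : finType).
Implicit Types (al : X -> L) (s : seq Gamma).

(** The itinerary of [x]: an equivariant coding of the action by labels, which carries [mu] to a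
    shift-invariant measure. *)
Definition conf (al : X -> L) (x : X) : Gamma -> L := fun g => al (a g x).

(** Multiplying the argument on the right makes this a left action. *)
Definition shift (g : Gamma) (z : Gamma -> L) : Gamma -> L := fun h => z (h * g)%g.

Lemma conf_act al g x : conf al (a g x) = shift g (conf al x).
Proof. by apply: funext => h; rewrite /conf /shift actM. Qed.

Definition depends_on U (s : seq Gamma) (Phi : (Gamma -> L) -> U) :=
  forall z z', {in s, z =1 z'} -> Phi z = Phi z'.

Definition pattern (al : X -> L) (s : seq Gamma) (x : X) : (size s).-tuple L :=
  map_tuple (conf al x) (in_tuple s).

(** Off [s] the value is the default [l]; a function that depends on [s] takes the same value at the
    extended pattern as at the itinerary itself. *)
Definition extend (s : seq Gamma) (l : L) (t : seq L) : Gamma -> L :=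
  fun g => nth l t (index g s).

Lemma extend_pattern al s l x : {in s, extend s l (pattern al s x) =1 conf al x}.
Proof.
move=> g gs; rewrite /extend /= (nth_map g) ?index_mem//.
by rewrite nth_index.
Qed.

Lemma labeling_act al g : measurable_labeling al ->
  measurable_labeling (fun x => al (a g x)).
Proof. by move=> mal i; exact: (measurable_act_preimage a g (mal i)). Qed.

Lemma labeling_pattern al s : measurable_labeling al ->
  measurable_labeling (pattern al s).
Proof.
move=> mal t.
rewrite (_ : _ @^-1` _ =
    \bigcap_(i : 'I_(size s))
      ((fun x => al (a (tnth (in_tuple s) i) x)) @^-1` [set tnth t i])).
  by apply: fin_bigcap_measurable => // i _; exact: labeling_act.
apply/seteqP; split => [x /= <- i _|x /= xt]; first by rewrite /= tnth_map.
by apply: eq_from_tnth => i; rewrite tnth_map; exact: xt.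
Qed.

End Configurations.

(** * Weak containment and functions of finitely many coordinates *)

Section WeakContainment.
Context (Gamma : groupType) (R : realType).
Context dX (X : measurableType dX) (mu : probability X R).
Context dY (Y : measurableType dY) (nu : probability Y R).
Variables (a : mp_action Gamma mu) (b : mp_action Gamma nu).
Hypothesis ab : a ≺ b.

Lemma wc_labeling (L : finType) (al : X -> L) (s : seq Gamma) (e : R) :
  measurable_labeling al -> 0 < e ->
  exists2 be : Y -> L, measurable_labeling be & forall g i j, g \in s ->
    `|pr mu [set x | al (a g x) = i /\ al x = j] -
      pr nu [set y | be (b g y) = i /\ be y = j]| < e.
Proof.
move=> mal e0.
pose A (i : 'I_#|L|) := (enum_rank \o al) @^-1` [set i].
have mA : measurable_labeling (enum_rank \o al) by exact: labeling_comp.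
(* Weak containment is defined with images; the image under [g^-1] is the preimage under [g], so the
   inverses of [s] are supplied. *)
have [B + AB] := ab (labeling_partition mA) (finite_seq [seq g^-1%g | g <- s]) e0.
move=> /partition_labeling[be mbe BE].
exists (enum_val \o be); first exact: labeling_comp.
move=> g i j gs.
have gVs : [set` [seq g^-1%g | g <- s]] g^-1%g by rewrite /= map_f.
have := AB _ (enum_rank i) (enum_rank j) gVs.
rewrite !act_image invgK !BE !prE ?abse_EFin ?lte_fin; last 2 first.
- by apply: measurableI; [exact: measurable_act_preimage|].
- by apply: measurableI; [exact: measurable_act_preimage|].
rewrite [in X in _ -> X](_ : [set x | al (a g x) = i /\ al x = j] =
    a g @^-1` ((enum_rank \o al) @^-1` [set enum_rank i]) `&`
      (enum_rank \o al) @^-1` [set enum_rank j]); last first.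
  by apply/seteqP; split => x /= [] => [-> ->//|/enum_rank_inj + /enum_rank_inj].
rewrite [in X in _ -> X](_ : [set y | _ /\ _] =
    b g @^-1` (be @^-1` [set enum_rank i]) `&` be @^-1` [set enum_rank j])//.
by apply/seteqP; split => y /= [] => [<- <-|-> ->]; rewrite ?enum_valK ?enum_rankK.
Qed.

(** Weak containment controls only pairs of coordinates, while [Phi] reads many at once. So each
    point is labeled by its whole pattern over [s] in addition to its label. The approximating
    labeling then predicts a pattern [q], and pair correlations force [q] to agree with the true
    pattern [r] off a small set. *)
Lemma wc_conf (L : finType) (al : X -> L) (s : seq Gamma)
    (Phi : (Gamma -> L) -> R) (e : R) :
  measurable_labeling al -> depends_on s Phi -> 0 < e ->
  exists2 be : Y -> L, measurable_labeling be &
    `|\int[mu]_x Phi (conf a al x) - \int[nu]_y Phi (conf b be y)| < e.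
Proof.
move=> mal Phis e0.
have [x0 _] := probability_nonempty mu.
pose l0 := al x0.
pose n := size s.
pose Psi (t : n.-tuple L) := Phi (extend s l0 t).
have PhiE d' (T : measurableType d') (P : probability T R)
    (c : mp_action Gamma P) (ga : T -> L) x :
    Phi (conf c ga x) = Psi (pattern c ga s x).
  by apply: Phis => g gs; rewrite extend_pattern.
pose U := (L * n.-tuple L)%type.
pose al' x : U := (al x, pattern a al s x).
have mal' : measurable_labeling al'.
  by apply: labeling_pair => //; exact: labeling_pattern.
pose M := \sum_t `|Psi t|.
(* The first summand pays for the change of distribution from [al'] to [be'], the second for the set
   where [q] and [r] differ, on which the values of [Psi] are at most [2 * M] apart. *)
pose C := \sum_(u : U) `|Psi u.2| + 2 * M * #|{: 'I_n * (U * U)}|%:R.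
have PsiM t : `|Psi t| <= M by rewrite /M (bigD1 t)//= lerDl sumr_ge0.
have M0 : 0 <= M by exact: sumr_ge0.
have C0 : 0 <= C by rewrite addr_ge0 ?sumr_ge0 ?mulr_ge0.
pose del := e / (C + 1).
have del0 : 0 < del by rewrite divr_gt0// ltr_wpDl.
have [be' mbe' be'P] := wc_labeling (1%g :: s) mal' del0.
pose be y := (be' y).1; pose q y := (be' y).2.
have mbe : measurable_labeling be by exact: (labeling_comp fst).
have mq : measurable_labeling q by exact: (labeling_comp snd).
exists be => //.
under eq_Rintegral do rewrite PhiE.
under [X in _ - X]eq_Rintegral do rewrite PhiE.
pose r := pattern b be s.
have mr : measurable_labeling r by exact: labeling_pattern.
(* The distributions of [al'] and [be'] are their correlations for [g = 1] with equal labels. *)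
have le1 : `|\int[mu]_x Psi (pattern a al s x) - \int[nu]_y Psi (q y)| <=
    del * \sum_(u : U) `|Psi u.2|.
  rewrite (mean_labeling mu (fun u => Psi u.2) mal').
  rewrite (mean_labeling nu (fun u => Psi u.2) mbe').
  rewrite -sumrB (le_trans (ler_norm_sum _ _ _))// mulr_sumr.
  apply: ler_sum => u _; rewrite -mulrBr normrM mulrC ler_wpM2r//.
  have := ltW (be'P 1%g u u (mem_head _ _)).
  rewrite (_ : [set x | _ /\ _] = al' @^-1` [set u]); last first.
    by apply/seteqP; split => x /=; rewrite act1 => // -[].
  rewrite (_ : [set y | _ /\ _] = be' @^-1` [set u])//.
  by apply/seteqP; split => x /=; rewrite act1 => // -[].
have mqr : measurable [set y | q y != r y].
  rewrite (_ : [set y | _] = (fun y => (q y, r y)) @^-1` [set p | p.1 != p.2])//.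
  by apply: labeling_preimage; exact: labeling_pair.
have pqr : pr nu [set y | q y != r y] <= #|{: 'I_n * (U * U)}|%:R * del.
  (* One way to mispredict the coordinate [p.1]: the translate has label [p.2.1], the point has
     label [p.2.2], and the two contradict each other. The same event for [al'] is empty, so for
     [be'] it has mass at most [del]. *)
  pose F (p : 'I_n * (U * U)) := [set y | [/\ tnth p.2.2.2 p.1 != p.2.1.1,
    be' (b (tnth (in_tuple s) p.1) y) = p.2.1 & be' y = p.2.2]].
  have mF0 (p : 'I_n * (U * U)) : measurable [set y |
      be' (b (tnth (in_tuple s) p.1) y) = p.2.1 /\ be' y = p.2.2].
    apply: measurableI; last exact: mbe'.
    exact: (labeling_act b _ mbe' p.2.1).
  refine (@pr_bigcup_fin _ _ _ nu ('I_n * (U * U))%type F del _ mqr _ _ _).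
  - move=> p; have [E|E] := boolP (tnth p.2.2.2 p.1 != p.2.1.1).
      rewrite (_ : F p = [set y |
        be' (b (tnth (in_tuple s) p.1) y) = p.2.1 /\ be' y = p.2.2])//.
      by apply/seteqP; split => y []; rewrite /F/= E.
    rewrite (_ : F p = set0)//.
    by apply/seteqP; split => y []; rewrite (negbTE E).
  - move=> p; have [E|E] := boolP (tnth p.2.2.2 p.1 != p.2.1.1); last first.
      rewrite (_ : F p = set0) ?pr0 ?ltW//.
      by apply/seteqP; split => y []; rewrite (negbTE E).
    have gs : tnth (in_tuple s) p.1 \in 1%g :: s by rewrite inE mem_tnth orbT.
    have := be'P _ p.2.1 p.2.2 gs.
    rewrite (_ : [set x | _ /\ al' x = _] = set0); last first.
      apply/seteqP; split => // x [/= h1 h2]; move: E; rewrite -h1 -h2 /=.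
      by rewrite tnth_map eqxx.
    rewrite pr0 sub0r normrN ger0_norm ?pr_ge0// => /ltW.
    apply: le_trans; apply: le_pr => //.
      rewrite (_ : F p = [set y |
        be' (b (tnth (in_tuple s) p.1) y) = p.2.1 /\ be' y = p.2.2])//.
      by apply/seteqP; split => y []; rewrite /F/= E.
    by move=> y [].
  - move=> y /= qr.
    have [i qi] : exists i, tnth (q y) i != tnth (r y) i.
      apply/existsP; move: qr; apply: contraNT; rewrite negb_exists => /forallP h.
      by apply/eqP/eq_from_tnth => i; apply/eqP; move: (h i); rewrite negbK.
    exists (i, (be' (b (tnth (in_tuple s) i) y), be' y)) => //.
    by split => //=; move: qi; rewrite /r tnth_map.
have bq : bmeas (fun y => Psi (q y)) by exact: bmeas_labeling.
have br : bmeas (fun y => Psi (r y)) by exact: bmeas_labeling.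
have le2 : `|\int[nu]_y Psi (q y) - \int[nu]_y Psi (r y)| <=
    2 * M * (#|{: 'I_n * (U * U)}|%:R * del).
  rewrite -meanB// (le_trans (norm_mean_le nu (bmeasB bq br)))//.
  apply: (@le_trans _ _ (\int[nu]_y (2 * M * \1_[set y | q y != r y] y))); last first.
    by rewrite meanZ ?mean_indic ?ler_wpM2l ?mulr_ge0//; exact: bmeas_indic.
  apply: le_mean => [||y]; [by bmeas_tac|by apply/bmeasZ/bmeas_indic|].
  rewrite indicE; have [->|qr] := eqVneq (q y) (r y).
    by rewrite subrr normr0 mulr_ge0 ?mulr_ge0.
  rewrite mem_set// mulr1 (le_trans (ler_normB _ _))// mulr_natl mulr2n.
  by rewrite lerD.
rewrite -(subrKA (\int[nu]_y Psi (q y))).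
rewrite (le_lt_trans (ler_normD _ _))// (le_lt_trans (lerD le1 le2))//.
rewrite (_ : _ + _ = del * C); last by rewrite /C; ring.
by rewrite /del mulrAC ltr_pdivrMr ?ltr_wpDl// ltr_pM2l// ltrDl.
Qed.

End WeakContainment.

(** * Fibres of a product action *)

Lemma sqr_lt_norm (R : realDomainType) (x e : R) : 0 < e -> x ^+ 2 < e ^+ 2 -> `|x| < e.
Proof.
move=> e0; rewrite -(real_normK (num_real x)) => xe.
by rewrite -(ltr_pXn2r (n := 2)) ?nnegrE// ltW.
Qed.

Section Sections.
Context (Gamma : groupType) (R : realType).
Context dX (X : measurableType dX) (mu : probability X R).
Context dZ (Z : measurableType dZ) (zeta : probability Z R).
Context dY (Y : measurableType dY) (nu : probability Y R).
Variables (a : mp_action Gamma mu) (c : mp_action Gamma zeta).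
Variable b : mp_action Gamma nu.
Hypothesis c_id : forall g z, c g z = z.

Lemma labeling_section (L : finType) (be : Z * Y -> L) z :
  measurable_labeling be -> measurable_labeling (fun y => be (z, y)).
Proof.
move=> mbe i; rewrite -[X in measurable X]setTI.
exact: (pair1_measurable z measurableT (mbe i)).
Qed.

Lemma conf_section (L : finType) (be : Z * Y -> L) z y :
  conf (prod_action c b) be (z, y) = conf b (fun y => be (z, y)) y.
Proof. by apply: funext => g; rewrite /conf /= /prod_act /= c_id. Qed.

(** By Tonelli's theorem the mean over the product is the mean of the means over the sections, so
    these cannot all be at least [e]. *)
Lemma section_mean_lt (f : Z * Y -> R) (e : R) :
  bmeas f -> (forall z, 0 <= f z) ->
  \int[product_probability zeta nu]_z f z < e ->
  exists z, \int[nu]_y f (z, y) < e.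
Proof.
move=> bf f0; apply: contraPP => /forallNP ge_e; apply/negP; rewrite -leNgt.
have bs z : bmeas (fun y => f (z, y)).
  case: bf => mf [M fM]; split; last by exists M.
  exact: (measurableT_comp mf (pair1_measurable z)).
have mf : measurable_fun [set: Z * Y] (EFin \o f).
  by apply/measurable_EFinP; case: bf.
rewrite -lee_fin -mean_EFin// [leRHS](fubini_tonelli1 (EFin \o f) mf)//.
have -> : e%:E = (\int[zeta]_z e%:E)%E.
  by rewrite mean_EFin ?mean_cst//; exact: bmeas_cst.
have [e0|e0] := leP e 0.
  apply: (@le_trans _ _ 0%E).
    by rewrite mean_EFin ?mean_cst ?lee_fin//; exact: bmeas_cst.
  by apply: integral_ge0 => z _; apply: integral_ge0 => y _; rewrite lee_fin.
apply: ge0_le_integral => //.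
- by move=> z _; rewrite lee_fin ltW.
- exact: (@measurable_fun_fubini_tonelli_F _ _ _ _ _ nu (EFin \o f)).
- by move=> z _; rewrite /fubini_F /= mean_EFin// lee_fin leNgt; apply/negP; exact: ge_e.
Qed.

Section Indicator.
Variables (T : seq (R * Gamma)) (L : finType).

(** Its mean along [conf] is a correlation of two labels. As a function on configurations it can be
    averaged over shifts and then handed to [wc_conf]. *)
Definition pair_ind (j : Gamma * L * L) (z : Gamma -> L) : R :=
  ((z j.1.1 == j.1.2) && (z 1%g == j.2))%:R.

Definition avg_ind (j : Gamma * L * L) (z : Gamma -> L) : R :=
  \sum_(p <- T) p.1 * pair_ind j (shift p.2 z).

Lemma bmeas_pair_ind dW (W : measurableType dW) (P : probability W R)
    (w : mp_action Gamma P) (be : W -> L) j : measurable_labeling be ->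
  bmeas (fun x => pair_ind j (conf w be x)).
Proof.
move=> mbe.
apply: (@bmeas_labeling _ _ R (L * L)%type
  (fun x => (be (w j.1.1 x), be (w 1%g x)))
  (fun q => ((q.1 == j.1.2) && (q.2 == j.2))%:R)).
by apply: labeling_pair; exact: labeling_act.
Qed.

Lemma mean_pair_ind dW (W : measurableType dW) (P : probability W R)
    (w : mp_action Gamma P) (be : W -> L) j : measurable_labeling be ->
  \int[P]_x pair_ind j (conf w be x) =
  pr P [set x | be (w j.1.1 x) = j.1.2 /\ be x = j.2].
Proof.
move=> mbe; rewrite -mean_indic; last first.
  by apply: measurableI; [exact: (labeling_act w j.1.1 mbe)|exact: mbe].
apply: eq_Rintegral => x _; rewrite indicE /pair_ind /conf act1; congr ((nat_of_bool _)%:R).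
apply/idP/idP => [/andP[/eqP h1 /eqP h2]|/set_mem [-> ->]]; last by rewrite !eqxx.
by rewrite mem_set.
Qed.

Lemma avg_indE dW (W : measurableType dW) (P : probability W R)
    (w : mp_action Gamma P) (be : W -> L) j x :
  avg_ind j (conf w be x) = avg w T (fun x => pair_ind j (conf w be x)) x.
Proof. by apply: eq_bigr => p _; rewrite conf_act. Qed.

End Indicator.

(** Correlations that are right on average over the fibres could be wrong on each of them. The
    functional [Phi] excludes this: it is small in mean only if the averaged indicators are nearly
    constant, with the right constants, and some fibre inherits this. *)
Theorem ergodic_wc_prod : countable [set: Gamma] -> ergodic a ->
  a ≺ prod_action c b -> a ≺ b.
Proof.
move=> cGamma erg acb k A F e /partition_labeling[al mal AE] /finite_seqP[s ->{F}] e0.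
pose J := ('I_(size s) * 'I_k * 'I_k)%type.
pose g_ (j : J) : Gamma * 'I_k * 'I_k := ((tnth (in_tuple s) j.1.1)^-1%g, j.1.2, j.2).
pose f j x := pair_ind (g_ j) (conf a al x).
have bf j : bmeas (f j) by exact: bmeas_pair_ind.
have mf j : measurable_fun [set: X] (f j) by case: (bf j).
have f1 j x : `|f j x| <= 1.
  by rewrite /f /pair_ind; case: (_ && _); rewrite ?normr1 ?normr0.
pose c_ j := \int[mu]_x f j x.
(* Each term of [Phi] has mean at most [e ^+ 2 / (2 * m)]; the extra 1 makes their sum strictly less
   than half of [e ^+ 2]. The other half is the error of [wc_conf]. *)
pose m : R := #|{: J}|%:R + 1.
have m0 : 0 < m by rewrite ltr_wpDl.
have e4 : 0 < e ^+ 2 / (2 * m) by rewrite divr_gt0// ?exprn_gt0// mulr_gt0.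
have [T cT Tf] := mean_ergodic mf f1 cGamma erg e4.
pose Phi z := \sum_j (avg_ind T (g_ j) z - c_ j) ^+ 2.
(* The coordinates that [Phi] reads: those of each pair indicator, moved by the group elements of
   [T]. *)
pose S := flatten [seq [seq h * p.2 | h <- 1 :: [seq (g_ j).1.1 | j : J]] | p <- T]%g.
have PhiS : depends_on S Phi.
  move=> z z' zz'; apply: eq_bigr => j _; congr ((_ - _) ^+ 2).
  rewrite /avg_ind big_seq [RHS]big_seq; apply: eq_bigr => p pT.
  have inS h : h \in 1%g :: [seq (g_ j).1.1 | j : J] -> (h * p.2)%g \in S.
    by move=> hS; apply/flatten_mapP; exists p => //; exact: (map_f (fun h => h * p.2)%g).
  rewrite /pair_ind /shift !zz'//; apply: inS; rewrite inE ?eqxx//.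
  by apply/orP; right; apply/mapP; exists j; rewrite ?mem_enum.
have bPhi dW (W : measurableType dW) (P : probability W R) (w : mp_action Gamma P)
    (be : W -> 'I_k) : measurable_labeling be -> bmeas (fun x => Phi (conf w be x)).
  move=> mbe; apply: bmeas_sum => j; apply: bmeas_sqr; apply: bmeasB; last exact: bmeas_cst.
  under eq_fun do rewrite avg_indE.
  exact/bmeas_avg/bmeas_pair_ind.
have Phi0 z : 0 <= Phi z by apply: sumr_ge0 => j _; exact: sqr_ge0.
have PhiX : \int[mu]_x Phi (conf a al x) < e ^+ 2 / 2.
  rewrite mean_sum; last first.
    move=> j; apply: bmeas_sqr; apply: bmeasB; last exact: bmeas_cst.
    under eq_fun do rewrite avg_indE.
    exact/bmeas_avg/bf.
  apply: (@le_lt_trans _ _ (\sum_(j : J) e ^+ 2 / (2 * m))).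
    apply: ler_sum => j _; apply: le_trans (Tf j).
    by under eq_Rintegral do rewrite avg_indE.
  rewrite sumr_const -[ltLHS]mulr_natr mulrAC ltr_pdivrMr ?mulr_gt0// /m.
  have := exprn_gt0 2 e0; set t := e ^+ 2; set n := #|_|%:R => t0.
  rewrite -subr_gt0 (_ : _ - _ = t) //; by field.
have e2 : 0 < e ^+ 2 / 2 by rewrite divr_gt0// exprn_gt0.
have [be mbe] := wc_conf acb mal PhiS e2.
rewrite distrC => /(le_lt_trans (ler_norm _)); rewrite ltrBlDr => PhiZY.
have {PhiZY} : \int[product_probability zeta nu]_x
    Phi (conf (prod_action c b) be x) < e ^+ 2.
  by apply: (lt_trans PhiZY); lra.
move=> /section_mean_lt[|//|t Phit]; first exact: bPhi.
have mbt := labeling_section t mbe.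
exists (fun i => (fun y => be (t, y)) @^-1` [set i]); first exact: labeling_partition.
move=> h i j hs.
have /tnthP[l hl] : h \in in_tuple s by [].
pose J0 : J := (l, i, j).
suff /(sqr_lt_norm e0) : (\int[nu]_y pair_ind (g_ J0) (conf b (fun y => be (t, y)) y) -
    c_ J0) ^+ 2 < e ^+ 2.
  rewrite /c_ !mean_pair_ind//= => lt_e.
  rewrite !act_image !AE hl !prE ?abse_EFin ?lte_fin.
  - by rewrite distrC.
  - by apply: measurableI; [exact: measurable_act_preimage|].
  - by apply: measurableI; [exact: measurable_act_preimage|].
rewrite (le_lt_trans _ Phit)//.
under [leRHS]eq_Rintegral do rewrite conf_section.
(* On the fibre, [T] preserves the mean, the squared error of the mean is at most the mean of the
   squared error, and this is one of the terms of [Phi]. *)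
rewrite -(mean_avg b cT); last exact: bmeas_pair_ind.
apply: (le_trans (sqr_mean_le nu (bmeas_avg _ _ (bmeas_pair_ind _ _ mbt)) _)).
apply: le_mean.
- apply: bmeas_sqr; apply: bmeasB; last exact: bmeas_cst.
  exact/bmeas_avg/bmeas_pair_ind.
- exact: bPhi.
- move=> y; rewrite /Phi (bigD1 J0)//= avg_indE lerDl.
  by apply: sumr_ge0 => i' _; exact: sqr_ge0.
Qed.

End Sections.

(** * The space of configurations *)

Lemma compact_nested_bigcap (T : topologicalType) (A : set T) (K : nat -> set T) :
  compact A -> (forall n, K n `<=` A) -> (forall n, closed (K n)) ->
  (forall n, K n !=set0) -> (forall n, K n.+1 `<=` K n) ->
  \bigcap_n K n !=set0.
Proof.
move=> cA KA cK K0 KS.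
have Kle m n : (m <= n)%N -> K n `<=` K m.
  move=> /subnK <-; elim: (n - m)%N => [|j IH] //.
  by rewrite addSn; apply: (subset_trans (KS _)).
have FF : ProperFilter (filter_from [set: nat] K).
  apply: filter_from_proper => [|n _]; last exact: K0.
  apply: filter_from_filter => [|m n _ _]; first by exists 0%N.
  exists (maxn m n) => // x Kx.
  by split; [apply: Kle Kx; exact: leq_maxl|apply: Kle Kx; exact: leq_maxr].
have [z [_ zF]] := cA (filter_from [set: nat] K) FF (ex_intro2 _ _ 0%N I (KA 0%N)).
exists z => n _; apply: cK => B; apply: zF.
by exists n.
Qed.

Definition config (Gamma : groupType) (k : nat) := Gamma -> 'I_k.+1.

Section ConfigCylinders.
Variables (Gamma : groupType) (k : nat).
Local Notation config := (config Gamma k).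

HB.instance Definition _ := gen_eqMixin config.
HB.instance Definition _ := gen_choiceMixin config.
HB.instance Definition _ := isPointed.Build config (fun=> ord0).

(** These are the clopen sets of a compact product space; on this algebra finite additivity already
    implies countable additivity. *)
Definition cylset (A : set config) :=
  exists s : seq Gamma, depends_on s (A : (Gamma -> 'I_k.+1) -> Prop).

Lemma cylset0 : cylset set0.
Proof. by exists [::]. Qed.

Lemma cylsetU : setU_closed cylset.
Proof.
move=> A B [s sA] [t tB]; exists (s ++ t) => z z' zz'.
by rewrite /setU /mkset (sA z z') 1?(tB z z')// => g gs;
  apply: zz'; rewrite mem_cat gs ?orbT.
Qed.

Lemma cylsetC : setC_closed cylset.
Proof. by move=> A [s sA]; exists s => z z' zz'; rewrite /setC /mkset (sA z z'). Qed.

HB.instance Definition _ := isAlgebraOfSets.Build default_measure_display config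
  cylset0 cylsetU cylsetC.

Lemma cylset_shift g (A : set config) : cylset A -> cylset (shift g @^-1` A).
Proof.
move=> [s sA]; exists [seq (h * g)%g | h <- s] => z z' zz'; apply: sA => h hs.
by apply: zz'; exact: (map_f (fun h => h * g)%g).
Qed.

Lemma cylset_coord g i : cylset [set z | z g = i].
Proof. by exists [:: g] => z z' zz'; rewrite /mkset zz'// inE. Qed.

(** By Tychonoff's theorem the product of finite discrete spaces is compact, and a set that depends
    on finitely many coordinates is closed in it. *)
Lemma cylset_compact (G : nat -> set config) : (forall n, cylset (G n)) ->
  (forall n, G n !=set0) -> (forall n, G n.+1 `<=` G n) -> \bigcap_n G n !=set0.
Proof.
pose T := prod_topology (fun _ : Gamma => discrete_topology 'I_k.+1).
have cT : compact [set: T].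
  have cI : compact [set: discrete_topology 'I_k.+1].
    by apply: finite_compact; exact: (@finite_finset 'I_k.+1 setT).
  have := @tychonoff Gamma (fun _ => discrete_topology 'I_k.+1) _ (fun _ => cI).
  by congr compact; apply/seteqP; split.
move=> cG G0 GS; apply: (@compact_nested_bigcap T setT G) => // n.
have [s sG] := cG n => z zG.
have : nbhs (z : T) [set z' | {in s, z =1 z'}].
  elim: s {sG} => [|g s IH].
    by apply: (@filterS _ _ (nbhs_filter (z : T)) setT _ _ filterT) => z' _ g.
  have Ng : nbhs (z : T) [set z' | z' g = z g].
    exact: (@proj_continuous _ (fun _ => discrete_topology 'I_k.+1) g z
      [set i | i = z g] (discrete_set1 _)).
  apply: (@filterS _ _ (nbhs_filter (z : T)) _ _ _
    (@filterI _ _ (nbhs_filter (z : T)) _ _ Ng IH)) => z' [/= zg zs] h.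
  by rewrite inE => /orP[/eqP -> //|]; exact: zs.
by move=> /zG[z' [Gz' zz']]; rewrite (sG _ _ zz').
Qed.

End ConfigCylinders.

Notation config_borel Gamma k :=
  (g_sigma_algebraType (@measurable _ (config Gamma k))).

(** * Shift-invariant means and the measures that they determine *)

Section InvariantMeans.
Variables (Gamma : groupType) (k : nat) (R : realType).
Local Notation config := (config Gamma k).
Local Notation borel := (config_borel Gamma k).

(** The bounds are imposed on every set in order to place the means in a cube that is compact for
    pointwise convergence; finite additivity is a closed condition there. *)
Definition cyl_mean (p : set config -> R) :=
  [/\ forall A, 0 <= p A <= 1, p setT = 1,
    forall A B, cylset A -> cylset B -> A `&` B = set0 -> p (A `|` B) = p A + p B &
    forall g A, cylset A -> p (shift g @^-1` A) = p A].

Lemma cyl_mean0 p : cyl_mean p -> p set0 = 0.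
Proof.
move=> [_ _ pU _]; have := pU _ _ (@cylset0 _ _) (@cylset0 _ _) (setI0 _).
by rewrite setU0; lra.
Qed.

Section Extension.
Variables (p : set config -> R) (mp : cyl_mean p).

Let mu (_ : cyl_mean p) (A : set config) : \bar R := (p A)%:E.

Let mu0 : mu mp set0 = 0%E. Proof. by rewrite /mu cyl_mean0. Qed.

Let mu_ge0 A : (0 <= mu mp A)%E.
Proof. by rewrite lee_fin; have [/(_ A)/andP[]] := mp. Qed.

(* By compactness, a disjoint union of cylinder sets that is a cylinder set has
   finitely many nonempty terms. *)
Let mu_sigma : semi_sigma_additive (mu mp).
Proof.
move=> F mF tF mUF; apply: cvg_near_cst.
have [n UFn] : exists n, \bigcup_i F i `<=` \big[setU/set0]_(i < n) F i.
  apply: contrapT => /forallNP nUF.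
  pose G n := (\bigcup_i F i) `\` \big[setU/set0]_(i < n) F i.
  have [z zG] : \bigcap_n G n !=set0.
    apply: cylset_compact => [n|n|n].
    - by apply: (@measurableD _ config) => //; exact: bigsetU_measurable.
    - by have /nonsubset := nUF n.
    - by rewrite /G big_ord_recr/= setDUr; exact: subIsetl.
  have [[i _ Fiz] _] := zG 0%N I; have [_] := zG i.+1 I.
  by apply; rewrite big_ord_recr; right.
exists n => // m /= nm.
have -> : \bigcup_i F i = \big[setU/set0]_(i < m) F i.
  apply/seteqP; split.
    by apply: (subset_trans UFn); exact: subset_bigsetU.
  by rewrite -bigcup_mkord => z [i _ Fz]; exists i.
rewrite /mu sumEFin big_mkord; congr (_%:E).
elim: m {nm} => [|m IH]; first by rewrite !big_ord0 cyl_mean0.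
have [_ _ pU _] := mp.
rewrite !big_ord_recr/= pU ?IH//; first exact: (@bigsetU_measurable _ config).
  exact: mF.
rewrite -(bigcup_mkord m F); apply/seteqP; split => // z [[i /= im Fiz] Fmz].
by move: im; rewrite (tF i m I I) ?ltnn//; exists z.
Qed.

HB.instance Definition _ := isMeasure.Build _ _ _ (mu mp) mu0 mu_ge0 mu_sigma.

Let nu (_ : cyl_mean p) : set borel -> \bar R := measure_extension (mu mp).

HB.instance Definition _ := Measure.on (nu mp).

Let nuE A : cylset A -> nu mp A = (p A)%:E.
Proof. by move=> cA; rewrite /nu /measure_extension measurable_mu_extE. Qed.

Let nuT : nu mp setT = 1%E.
Proof.
have [_ pT _ _] := mp.
by rewrite nuE; [exact: (congr1 EFin pT)|exact: (@measurableT _ config)].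
Qed.

HB.instance Definition _ := Measure_isProbability.Build _ _ _ (nu mp) nuT.

Lemma cyl_mean_extension :
  exists P : probability borel R, forall A, cylset A -> P A = (p A)%:E.
Proof. by exists (nu mp) => A cA; exact: nuE. Qed.

End Extension.

Lemma cylset_measurable (A : set config) : cylset A -> measurable (A : set borel).
Proof. exact: sub_sigma_algebra. Qed.

Lemma cyl_measure_unique (P Q : {measure set borel -> \bar R}) :
  (P setT < +oo)%E -> (forall A, cylset A -> P A = Q A) ->
  forall A, measurable A -> P A = Q A.
Proof.
move=> Pfin PQ A mA.
apply: (@measure_unique _ R borel (@cylset Gamma k) (fun=> setT)) => //.
- exact: (@measurableI _ config).
- by move=> _; exact: (@measurableT _ config).
- by apply/seteqP; split => // z _; exists 0%N.
Qed.

Lemma shift_measurable g :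
  measurable_fun [set: borel] (shift g : borel -> borel).
Proof.
apply: (@measurability _ _ borel borel _ _ (@cylset Gamma k)) => //.
move=> _ [A cA <-]; rewrite setTI; apply: cylset_measurable.
exact: cylset_shift.
Qed.

Section ShiftAction.
Variable P : probability borel R.
Hypothesis P_shift : forall g A, cylset A -> P (shift g @^-1` A) = P A.

Lemma shift1 (z : borel) : shift 1%g z = z.
Proof. by apply: funext => h; rewrite /shift mulg1. Qed.

Lemma shiftM g h (z : borel) : shift (g * h)%g z = shift g (shift h z).
Proof. by apply: funext => l; rewrite /shift mulgA. Qed.

Lemma shift_preserving g (A : set borel) :
  measurable A -> P (shift g @^-1` A) = P A.
Proof.
move=> mA; have mg := shift_measurable g.
pose Q := measure_function_pushforward__canonical__measure_function_Measure P mg.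
apply: (@cyl_measure_unique Q P) => //.
- by rewrite /Q /= /pushforward preimage_setT probability_setT ltry.
- by move=> B cB; exact: P_shift.
Qed.

Definition shift_action : mp_action Gamma P :=
  MpAction shift1 shiftM shift_measurable shift_preserving.

End ShiftAction.

Section FactorMean.
Context d (X : measurableType d) (mu : probability X R).
Variables (a : mp_action Gamma mu) (al : X -> 'I_k.+1).
Hypothesis mal : measurable_labeling al.

Lemma conf_measurable (A : set config) : cylset A ->
  measurable (conf a al @^-1` A).
Proof.
move=> [s sA].
rewrite (_ : _ @^-1` _ = pattern a al s @^-1` [set t | A (extend s ord0 t)]).
  exact/labeling_preimage/labeling_pattern.
by apply/seteqP; split => x /=; rewrite (sA _ (conf a al x))//;
  exact: extend_pattern.
Qed.

(** The law of the itinerary. The value 0 off the cylinder sets respects the bounds in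
    [cyl_mean]. *)
Definition factor_mean (A : set config) : R :=
  if `[< cylset A >] then pr mu (conf a al @^-1` A) else 0.

Lemma factor_meanE A : cylset A -> factor_mean A = pr mu (conf a al @^-1` A).
Proof. by move=> cA; rewrite /factor_mean asboolT. Qed.

Lemma factor_cyl_mean : cyl_mean factor_mean.
Proof.
split.
- move=> A; rewrite /factor_mean; case: asboolP => cA; last by rewrite lexx ler01.
  by rewrite pr_ge0 pr_le1//; exact: conf_measurable.
- by rewrite factor_meanE ?preimage_setT ?prT//; exact: (@measurableT _ config).
- move=> A B cA cB AB; rewrite !factor_meanE//; last exact: cylsetU.
  rewrite preimage_setU prU//; [exact: conf_measurable|exact: conf_measurable|].
  by rewrite -preimage_setI AB preimage_set0.
- move=> g A cA; rewrite !factor_meanE//; last exact: cylset_shift.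
  rewrite -(pr_act_preimage a g (conf_measurable cA)); congr pr.
  by apply/seteqP; split => x /=; rewrite conf_act.
Qed.

End FactorMean.

End InvariantMeans.

(** * Extreme invariant means *)

Section Argmin.
Context (T : topologicalType) (R : realType).

Lemma closed_eqfun (f g : T -> R) : continuous f -> continuous g ->
  closed [set p | f p = g p].
Proof.
move=> cf cg.
rewrite (_ : [set p | _] = (f \- g) @^-1` [set x | x = 0]).
  have /continuous_closedP : continuous (f \- g).
    by move=> p; apply: cvgB; [exact: cf|exact: cg].
  by apply; exact: closed_eq.
by apply/seteqP; split => p /=; [move=> ->; exact: subrr|exact: subr0_eq].
Qed.

Lemma continuous_sum_scale (J : finType) (c : J -> R) (f : J -> T -> R) :
  (forall j, continuous (f j)) -> continuous (fun p => \sum_j c j * f j p).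
Proof.
move=> cf; elim: (index_enum J) => [|j r IH] p.
  by under eq_fun do rewrite big_nil; exact: cvg_cst.
under eq_fun do rewrite big_cons.
by rewrite ?big_cons; apply: cvgD; [apply: cvgM; [exact: cvg_cst|exact: cf]|exact: IH].
Qed.

Lemma continuous_addf (f g : T -> R) : continuous f -> continuous g ->
  continuous (fun p => f p + g p).
Proof. by move=> cf cg p; apply: cvgD; [exact: cf|exact: cg]. Qed.

Definition argmin (K : set T) (f : T -> R) : set T :=
  [set p | K p /\ forall q, K q -> f p <= f q].

Lemma argmin_nonempty (K : set T) f : compact K -> K !=set0 -> continuous f ->
  argmin K f !=set0.
Proof.
move=> cK K0 cf.
have [|p pK fp] := compact_EVT_min K0 cK (f := f); first exact: continuous_subspaceT.
by exists p; split; [exact: set_mem|move=> q /mem_set; exact: fp].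
Qed.

Lemma argmin_closed (K : set T) f : closed K -> continuous f -> closed (argmin K f).
Proof.
move=> cK cf.
rewrite (_ : argmin K f = K `&` \bigcap_(q in K) f @^-1` [set x | x <= f q]).
  apply: closedI => //; apply: closed_bigI => q _.
  by move/continuous_closedP: cf; apply; exact: closed_le.
by apply/seteqP; split => p /= [].
Qed.

(** Minimizers form a face: [f y] and [f z] are at least the minimum, and their weighted average
    attains it. *)
Lemma argmin_extreme (K : set T) f x y z (t : R) : 0 < t < 1 ->
  argmin K f x -> K y -> K z -> f x = t * f y + (1 - t) * f z ->
  [/\ argmin K f y, argmin K f z & f y = f x].
Proof.
move=> /andP[t0 t1] [Kx xmin] Ky Kz fx.
have xy := xmin _ Ky; have xz := xmin _ Kz.
have yx : f y = f x.
  apply/eqP; rewrite eq_le xy andbT -(ler_pM2l t0).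
  by have := ler_wpM2l (ltW (_ : 0 < 1 - t)) xz; rewrite subr_gt0 => /(_ t1); lra.
have zx : f z = f x.
  apply/eqP; rewrite eq_le xz andbT -(ler_pM2l (_ : 0 < 1 - t)) ?subr_gt0//.
  by have := ler_wpM2l (ltW t0) xy; lra.
by split => //; split => // q /xmin; rewrite ?yx ?zx.
Qed.

End Argmin.

Section ExtremeMeans.
Variables (Gamma : groupType) (k : nat) (R : realType).
Local Notation config := (config Gamma k).
Local Notation borel := (config_borel Gamma k).

Let T := prod_topology (fun _ : set config => R).

Let eval_continuous A : continuous (fun p : T => p A).
Proof. by move=> p; exact: (@proj_continuous _ (fun _ => R) A). Qed.

Lemma cyl_mean_closed : closed (@cyl_mean Gamma k R : set T).
Proof.
rewrite (_ : @cyl_mean Gamma k R =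
  (\bigcap_A ((fun p : T => p A) @^-1` [set x | 0 <= x] `&`
     (fun p : T => p A) @^-1` [set x | x <= 1])) `&`
  [set p : T | p setT = 1] `&`
  (\bigcap_(D in [set D : set config * set config |
      [/\ cylset D.1, cylset D.2 & D.1 `&` D.2 = set0]])
    [set p : T | p (D.1 `|` D.2) = p D.1 + p D.2]) `&`
  (\bigcap_(D in [set D : Gamma * set config | cylset D.2])
    [set p : T | p (shift D.1 @^-1` D.2) = p D.2])).
  apply: closedI; [apply: closedI; [apply: closedI|]|].
  - apply: closed_bigI => A _; have /continuous_closedP cA := @eval_continuous A.
    by apply: closedI; apply: cA; [exact: closed_ge|exact: closed_le].
  - by apply: closed_eqfun; [exact: eval_continuous|exact: cst_continuous].
  - apply: closed_bigI => D _; apply: closed_eqfun; first exact: eval_continuous.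
    by apply: continuous_addf; exact: eval_continuous.
  - by apply: closed_bigI => D _; apply: closed_eqfun; exact: eval_continuous.
apply/seteqP; split => p /=.
  move=> [p01 pT pU pS]; split; [split; [split|]|] => //.
  - by move=> A _; have /andP[] := p01 A.
  - by move=> [A B] /= [cA cB AB]; exact: pU.
  - by move=> [g A] /= cA; exact: pS.
move=> [[[p01 pT] pU] pS]; split => //.
- by move=> A; have [/= -> ->] := p01 A I.
- by move=> A B cA cB AB; exact: (pU (A, B)).
- by move=> g A cA; exact: (pS (g, A)).
Qed.

Lemma cyl_mean_compact : compact (@cyl_mean Gamma k R : set T).
Proof.
have box : compact [set p : T | forall A, 0 <= p A <= 1].
  have := @tychonoff (set config) (fun _ => R) (fun _ => [set` `[0, 1]%R])
    (fun _ => @segment_compact _ _ _).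
  by congr compact; under [LHS]eq_set do under eq_forall do rewrite /= in_itv/=.
by apply: (subclosed_compact cyl_mean_closed box) => p [].
Qed.

Definition cyl (w : seq (Gamma * 'I_k.+1)) : set config :=
  [set z | forall q, q \in w -> z q.1 = q.2].

Lemma cylset_cyl w : cylset (cyl w).
Proof.
exists (map fst w) => z z' zz'; apply/propext; split => h q qw.
  by rewrite -zz' ?h//; exact: map_f.
by rewrite zz' ?h//; exact: map_f.
Qed.

Lemma cylsetI (A B : set config) : cylset A -> cylset B -> cylset (A `&` B).
Proof. exact: (@measurableI _ config). Qed.

(** A set that depends on [s] is split by the value at one coordinate after another, until only the
    cylinders [cyl w] remain. *)
Lemma eq_cyl_mean (p q : set config -> R) : cyl_mean p -> cyl_mean q ->
  (forall w, p (cyl w) = q (cyl w)) -> forall A, cylset A -> p A = q A.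
Proof.
move=> mp mq pq A [s sA].
have psplit (p' : set config -> R) g (B : set config) : cyl_mean p' -> cylset B ->
    p' B = \sum_(i <- enum 'I_k.+1) p' (B `&` [set z | z g = i]).
  move=> mp' cB.
  have cBi i : cylset (B `&` [set z | z g = i]).
    by apply: cylsetI => //; exact: cylset_coord.
  suff H : forall r : seq 'I_k.+1, uniq r ->
      p' (B `&` [set z | z g \in r]) = \sum_(i <- r) p' (B `&` [set z | z g = i]).
    rewrite -H ?enum_uniq//; congr p'; apply/seteqP; split => [z Bz|z []//].
    by split => //=; rewrite mem_enum.
  elim=> [_|i r IH /= /andP[ir ur]].
    by rewrite big_nil -[RHS](cyl_mean0 mp'); congr p'; apply/seteqP; split => z // [].
  have [_ _ pU _] := mp'.
  rewrite big_cons -IH// -pU//.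
  - congr p'; apply/seteqP; split => z /=.
      by move=> [Bz]; rewrite inE => /orP[/eqP|] ?; [left|right].
    by move=> [] [Bz zi]; split => //; rewrite inE ?zi ?eqxx ?orbT.
  - apply: cylsetI => //; exists [:: g] => z z' zz'.
    by rewrite /mkset zz'// inE.
  - apply/seteqP; split => // z [[_ /= zi] [_ /= zr]].
    by move: ir; rewrite -zi zr.
(* The word [w] records the coordinates already fixed during the induction on [s]. *)
suff H : forall w, p (cyl w `&` A) = q (cyl w `&` A).
  rewrite (_ : A = cyl [::] `&` A)//; apply/seteqP; split => z; last by case.
  by move=> Az; split => // q'; rewrite in_nil.
elim: s A sA => [|g s IH] A sA w.
  have [[z Az]|A0] := pselect (exists z, A z).
    rewrite (_ : _ `&` _ = cyl w); first exact: pq.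
    by apply/seteqP; split => [z' []//|z' wz']; split => //; rewrite -(sA z).
  rewrite (_ : _ `&` _ = set0) ?cyl_mean0//; apply/seteqP; split => // z [_ Az].
  by apply: A0; exists z.
have cA : cylset A by exists (g :: s).
have cwA : cylset (cyl w `&` A) by apply: cylsetI => //; exact: cylset_cyl.
rewrite (psplit p g)// (psplit q g)//; apply: eq_bigr => i _.
(* Overwriting the coordinate [g] by [i] yields a set that depends on the rest of [s] and agrees
   with [A] where that coordinate is [i]. *)
pose upd (z : config) : config := fun h => if h == g then i else z h.
have -> : cyl w `&` A `&` [set z | z g = i] = cyl ((g, i) :: w) `&` [set z | A (upd z)].
  have updE z : z g = i -> upd z = z.
    by move=> zg; apply: funext => h; rewrite /upd; case: eqP => [->|].
  apply/seteqP; split => z /=.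
    move=> [[wz Az] zg]; rewrite updE//; split => // q'.
    by rewrite inE => /orP[/eqP -> //|]; exact: wz.
  move=> [wz]; have zg : z g = i by apply: (wz (g, i)); exact: mem_head.
  rewrite updE// => Az; split => //; split => // q' q'w.
  by apply: wz; rewrite inE q'w orbT.
apply: IH => z z' zz'; apply: sA => h; rewrite inE /upd.
by case: eqP => //= _; exact: zz'.
Qed.

Section LexicographicMinimum.
Variables (e : nat -> Gamma) (J : finType) (A : J -> set config) (c : J -> R).
Hypothesis esurj : forall g, exists n, e n = g.
Hypothesis cA : forall j, cylset (A j).

Let phi (p : T) : R := \sum_j c j * p (A j).

Let phi_continuous : continuous phi.
Proof. by apply: continuous_sum_scale => j; exact: eval_continuous. Qed.

(** Words are coded over [nat] by means of [e]. A code that decodes to no word gives [setT], again a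
    cylinder set, so every index can be used in the minimization. *)
Definition enum_cyl n : set config :=
  if @unpickle (seq (nat * 'I_k.+1)) n is Some w
  then cyl [seq (e q.1, q.2) | q <- w] else setT.

Lemma enum_cylP w : exists n, enum_cyl n = cyl w.
Proof.
pose v := [seq (sval (cid (esurj q.1)), q.2) | q <- w].
exists (pickle v); rewrite /enum_cyl pickleK -map_comp; congr cyl.
rewrite -[RHS]map_id; apply: eq_map => -[g i] /=.
by congr pair; exact: svalP (cid (esurj g)).
Qed.

Lemma cylset_enum_cyl n : cylset (enum_cyl n).
Proof.
rewrite /enum_cyl; case: unpickle => [w|]; first exact: cylset_cyl.
exact: (@measurableT _ config).
Qed.

(** Each face minimizes the mass of one more cylinder on the preceding face, so on the intersection
    of all faces every cylinder has a determined mass. *)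
Fixpoint min_face n : set T :=
  if n is n'.+1 then argmin (min_face n') (fun p : T => p (enum_cyl n'))
  else argmin (@cyl_mean Gamma k R : set T) phi.

Lemma min_face_sub n : min_face n `<=` (@cyl_mean Gamma k R : set T).
Proof. by elim: n => [|n IH] p [] //; move=> /IH. Qed.

Lemma min_face_closed n : closed (min_face n).
Proof.
elim: n => [|n IH] /=; apply: argmin_closed => //.
exact: cyl_mean_closed.
Qed.

Lemma min_face_compact n : compact (min_face n).
Proof.
exact: subclosed_compact (@min_face_closed n) cyl_mean_compact (@min_face_sub n).
Qed.

(** By [argmin_extreme] both ends of a segment through [p] lie on every face, so they give each
    cylinder the same minimal mass as [p]. Cylinders determine a mean on cylinder sets only, whence
    this form of extremality. *)
Lemma lexicographic_minimum (p0 : T) : cyl_mean p0 ->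
  exists p : T, [/\ cyl_mean p, phi p <= phi p0 &
    forall y z t, cyl_mean y -> cyl_mean z -> 0 < t < 1 ->
      (forall B, cylset B -> p B = t * y B + (1 - t) * z B) ->
      forall B, cylset B -> y B = p B].
Proof.
move=> mp0.
have ne n : min_face n !=set0.
  elim: n => [|n IH] /=; apply: argmin_nonempty => //.
  - exact: cyl_mean_compact.
  - by exists p0.
  - exact: min_face_compact.
have [p pK] : \bigcap_n min_face n !=set0.
  apply: (compact_nested_bigcap cyl_mean_compact) => [n|n|//|n].
  - exact: min_face_sub.
  - exact: min_face_closed.
  - by move=> q [].
have mp : cyl_mean p := min_face_sub (pK 0%N I).
exists p; split => //; first by have [_] := pK 0%N I; apply.
move=> y z t my mz t01 pyz.
have yz n : min_face n y /\ min_face n z.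
  elim: n => [|n [yn zn]].
    have [] := @argmin_extreme _ _ _ phi p y z t t01 (pK 0%N I) my mz => //.
    rewrite /phi !mulr_sumr -big_split; apply: eq_bigr => j _ /=.
    by rewrite pyz//; ring.
  have [] := @argmin_extreme _ _ _ (fun p : T => p (enum_cyl n))
    p y z t t01 (pK n.+1 I) yn zn => //.
  by apply: pyz; exact: cylset_enum_cyl.
apply: eq_cyl_mean => // w; have [n <-] := enum_cylP w.
have [yn zn] := yz n.
have [] := @argmin_extreme _ _ _ (fun p : T => p (enum_cyl n))
    p y z t t01 (pK n.+1 I) yn zn => //.
by apply: pyz; exact: cylset_enum_cyl.
Qed.

End LexicographicMinimum.

Definition cond_mean (P : probability borel R) (S : set borel) (A : set config) : R :=
  if `[< cylset A >] then pr P (A `&` S) / pr P S else 0.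

Lemma cond_cyl_mean (P : probability borel R) (S : set borel) : measurable S ->
  0 < pr P S -> (forall g A, cylset A -> P (shift g @^-1` A) = P A) ->
  (forall g, shift g @^-1` S = S) -> cyl_mean (cond_mean P S).
Proof.
move=> mS S0 Pinv Sinv.
have mI (A : set config) : cylset A -> measurable ((A : set borel) `&` S).
  by move=> cA; apply: measurableI => //; exact: cylset_measurable.
split.
- move=> A; rewrite /cond_mean; case: asboolP => cA; last by rewrite lexx ler01.
  rewrite divr_ge0 ?pr_ge0//= ler_pdivrMr// mul1r; apply: le_pr => //.
  exact: mI.
- by rewrite /cond_mean asboolT ?setTI ?divff ?gt_eqF//; exact: (@measurableT _ config).
- move=> A B cA cB AB; rewrite /cond_mean !asboolT//; last exact: cylsetU.
  rewrite setIUl prU ?mulrDl//; [exact: mI|exact: mI|].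
  by rewrite setIACA AB set0I.
- move=> g A cA; rewrite /cond_mean !asboolT//; last exact: cylset_shift.
  congr (_ / _); rewrite -[in LHS](Sinv g) -preimage_setI /pr.
  by rewrite -[in RHS](shift_preserving Pinv g (mI _ cA)).
Qed.

(** The functional is minimized at an extreme mean, and extreme means are ergodic: an invariant set
    [S] of mass strictly between 0 and 1 would decompose [P] into its conditional measures on [S]
    and on the complement. *)
Theorem exists_ergodic_le (J : finType) (A : J -> set config) (c : J -> R)
    (p0 : set config -> R) : countable [set: Gamma] ->
  (forall j, cylset (A j)) -> cyl_mean p0 ->
  exists (P : probability borel R) (b : mp_action Gamma P),
    [/\ forall g, b g = shift g, ergodic b &
        \sum_j c j * pr P (A j) <= \sum_j c j * p0 (A j)].
Proof.
move=> /countable_enum[e esurj] cA mp0.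
have [p [mp phip pext]] := @lexicographic_minimum e J A c esurj cA p0 mp0.
have [P PE] := cyl_mean_extension mp.
have Pinv g B : cylset B -> P (shift g @^-1` B) = P B.
  by move=> cB; rewrite !PE//; [have [_ _ _ ->] := mp|exact: cylset_shift].
have prPE B : cylset B -> pr P B = p B by move=> cB; rewrite /pr PE.
exists P, (shift_action Pinv); split => //; last first.
  by rewrite (eq_bigr (fun j => c j * p (A j)))// => j _; rewrite prPE.
move=> S mS Sinv.
have {}Sinv g : shift g @^-1` S = S.
  by have := Sinv g^-1%g; rewrite act_image invgK.
have [S0|S0] := eqVneq (pr P S) 0; first by left; rewrite prE// S0.
have [S1|S1] := eqVneq (pr P S) 1; first by right; rewrite prE// S1.
have Sgt0 : 0 < pr P S by rewrite lt_neqAle eq_sym S0 pr_ge0.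
have Slt1 : pr P S < 1 by rewrite lt_neqAle S1 pr_le1.
have mSC : measurable (~` S) by exact: measurableC.
have SCgt0 : 0 < pr P (~` S) by rewrite pr_setC// subr_gt0.
have SCinv g : shift g @^-1` (~` S) = ~` S by exact: (congr1 setC (Sinv g)).
have := pext _ _ (pr P S) (cond_cyl_mean mS Sgt0 Pinv Sinv)
  (cond_cyl_mean mSC SCgt0 Pinv SCinv).
rewrite Sgt0 Slt1 => /(_ isT) H.
(* Extremality identifies the conditional measure on [S] with [P], so [S] is independent of every
   cylinder set. *)
have {}H B : cylset B -> pr P (B `&` S) = pr P S * pr P B.
  move=> cB; have mB := cylset_measurable cB.
  rewrite (prPE B cB) -H//; first by rewrite /cond_mean asboolT// mulrC divfK// gt_eqF.
  move=> C cC; have mC := cylset_measurable cC.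
  rewrite /cond_mean asboolT// -pr_setC// -prPE// (prID P mC mS).
  by rewrite [pr P S * _]mulrC [pr P (~` S) * _]mulrC !divfK ?gt_eqF.
have tS : 0 <= pr P S by exact: pr_ge0.
(* Independence extends from cylinder sets to Borel sets, in particular to [S] itself, so the mass
   of [S] equals its square. *)
have : mrestr P mS S = mscale (NngNum tS) P S.
  apply: (@cyl_measure_unique Gamma k R) => // [|B cB].
    by rewrite /= /mrestr setTI prE// ltry.
  have mB := cylset_measurable cB.
  rewrite /= /mrestr /mscale /= (@prE _ _ _ P B)// prE; last exact: measurableI.
  by rewrite H.
rewrite /mrestr /mscale /= setIid prE//.
rewrite -EFinM => -[] /esym/eqP; rewrite -subr_eq0 -[X in _ - X]mulr1 -mulrBr.
by rewrite mulf_eq0 (negbTE S0) subr_eq0 (negbTE S1).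
Qed.

End ExtremeMeans.

(** * The configurations form a standard Borel space *)

Section ConfigMetric.
Variables (R : realType) (Gamma : groupType) (k : nat) (e : nat -> Gamma).
Hypothesis esurj : forall g, exists n, e n = g.

Definition agree n (z z' : config Gamma k) :=
  forall i, (i < n)%N -> z (e i) = z' (e i).

Definition cdist (z z' : config Gamma k) : R :=
  if pselect (exists n, z (e n) != z' (e n)) is left h
  then 2^-1 ^+ ex_minn h else 0.

(** Closed balls of radius [2^-n] are cylinders, which turns the metric statements below into
    statements about finitely many coordinates. *)
Lemma cdist_le n z z' : cdist z z' <= 2^-1 ^+ n <-> agree n z z'.
Proof.
have h01 : 0 < 2^-1 :> R by rewrite invr_gt0.
have h1 : 2^-1 < 1 :> R by rewrite invf_lt1// ltr1n.
rewrite /cdist; case: pselect => [h|h]; last first.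
  split => [_ i _|_]; last by rewrite exprn_ge0// ltW.
  by apply/eqP/negPn/negP => zi; apply: h; exists i.
case: ex_minnP => m zm mmin; split => [mn i ilt|zz'].
  apply/eqP/negPn/negP => /mmin mi; move: mn; rewrite leNgt => /negP; apply.
  rewrite -subr_gt0.
  have -> : 2^-1 ^+ n = 2^-1 ^+ m * 2^-1 ^+ (n - m) :> R.
    by rewrite -exprD subnKC// (leq_trans mi)// ltnW.
  rewrite -[X in X - _]mulr1 -mulrBr mulr_gt0 ?exprn_gt0// subr_gt0.
  by rewrite exprn_ilt1 ?(ltW h01)// subn_eq0 -ltnNge (leq_ltn_trans mi).
rewrite ler_wiXn2l ?ltW//.
by rewrite leqNgt; apply/negP => /zz' /eqP; rewrite (negbTE zm).
Qed.

Lemma cdist_ge0 z z' : 0 <= cdist z z'.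
Proof. by rewrite /cdist; case: pselect => // h; rewrite exprn_ge0// invr_ge0. Qed.

Lemma cdistxx z : cdist z z = 0.
Proof. by rewrite /cdist; case: pselect => // h; have [n /eqP] := h. Qed.

Lemma cdist_pos z z' : cdist z z' = 0 -> z = z'.
Proof.
move=> d0; apply: funext => g; have [n <-] := esurj g.
have /cdist_le/(_ n (ltnSn n)) // : cdist z z' <= 2^-1 ^+ n.+1.
by rewrite d0 exprn_ge0// invr_ge0.
Qed.

Lemma cdist_sym z z' : cdist z z' = cdist z' z.
Proof.
rewrite /cdist; case: pselect => h; case: pselect => h'.
- by congr (_ ^+ _); apply: eq_ex_minn => n; rewrite eq_sym.
- by exfalso; apply: h'; have [j zj] := h; exists j; rewrite eq_sym.
- by exfalso; apply: h; have [j zj] := h'; exists j; rewrite eq_sym.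
- by [].
Qed.

(** The distance is an ultrametric: [x] and [z] agree at least as far as both [x] with [y] and [y]
    with [z] do. *)
Lemma cdist_triangle y x z : cdist x z <= cdist x y + cdist y z.
Proof.
have key m n : cdist x y = 2^-1 ^+ m -> cdist y z = 2^-1 ^+ n -> (m <= n)%N ->
    cdist x z <= cdist x y /\ agree m y z.
  move=> xy yz mn; have /cdist_le xym : cdist x y <= 2^-1 ^+ m by rewrite xy.
  have /cdist_le yzn : cdist y z <= 2^-1 ^+ n by rewrite yz.
  have yzm : agree m y z by move=> i im; apply: yzn; exact: leq_trans im mn.
  split => //; rewrite xy; apply/cdist_le => i im.
  by rewrite xym ?yzm.
have [->|xy] := eqVneq x y; first by rewrite cdistxx add0r.
have [->|yz] := eqVneq y z; first by rewrite cdistxx addr0.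
have pow (u v : config Gamma k) : u != v -> exists n, cdist u v = 2^-1 ^+ n.
  move=> uv; rewrite /cdist; case: pselect => h; first by exists (ex_minn h).
  move/eqP: uv => []; apply: funext => g; have [n <-] := esurj g.
  by apply/eqP/negPn/negP => ?; apply: h; exists n.
have [m xym] := pow _ _ xy; have [n yzn] := pow _ _ yz.
have [mn|/ltnW nm] := leqP m n.
  by have [/le_trans + _] := key _ _ xym yzn mn; apply; rewrite lerDl cdist_ge0.
have /cdist_le xya : cdist x y <= 2^-1 ^+ m by rewrite xym.
have /cdist_le yza : cdist y z <= 2^-1 ^+ n by rewrite yzn.
apply: (@le_trans _ _ (cdist y z)); last by rewrite lerDr cdist_ge0.
by rewrite yzn; apply/cdist_le => i im; rewrite xya ?yza// (leq_trans im).
Qed.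

(** Surjectivity of [e] is a parameter of the type because distance zero forces equality only if [e]
    reaches every coordinate. *)
Definition config_metric of (forall g, exists n, e n = g) : Type := config Gamma k.
Local Notation M := (config_metric esurj).

HB.instance Definition _ := Choice.copy M (config Gamma k).
HB.instance Definition _ := isMetric.Build R M cdistxx cdist_pos cdist_sym
  cdist_triangle.

Let pow_small (r : R) : 0 < r -> exists n, 2^-1 ^+ n < r.
Proof.
move=> r0; exists (Num.bound r^-1); rewrite exprVn invf_plt ?posrE//.
rewrite (lt_le_trans (archi_boundP _))//; first by rewrite invr_ge0 ltW.
by rewrite -natrX ler_nat ltnW// ltn_expl.
Qed.

Let ball_agree n (z : M) : ball z (2^-1 ^+ n : R) `<=` agree n z.
Proof. by rewrite ballEmdist => y /= /ltW /cdist_le. Qed.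

Let nbhs_agree (z : M) (B : set M) : nbhs z B -> exists n, agree n z `<=` B.
Proof.
move=> /(@nbhs_ballP R)[r /= r0 rB]; have [n nr] := pow_small r0.
exists n => y zy; apply: rB; rewrite ballEmdist /=.
by apply: le_lt_trans nr; exact/cdist_le.
Qed.

Let agree_nbhs (z : M) n : nbhs z (agree n z).
Proof.
apply/(@nbhs_ballP R); exists (2^-1 ^+ n); last exact: ball_agree.
by rewrite /= exprn_gt0// invr_gt0.
Qed.

Let idx g := sval (cid (esurj g)).

Let eidx g : e (idx g) = g. Proof. exact: svalP (cid (esurj g)). Qed.

Lemma config_metric_complete (F : set_system M) :
  ProperFilter F -> cauchy F -> exists l : M, F --> l.
Proof.
move=> FF /(@cauchyP R M F FF) cF.
have /choice[x xF] : forall n, exists x : M, F (agree n x).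
  move=> n; have [|x Fx] := cF (2^-1 ^+ n); first by rewrite exprn_gt0// invr_gt0.
  by exists x; apply: filterS Fx; exact: ball_agree.
(* Agreement up to [(idx g).+1] is the first that includes the index [idx g], so this centre already
   has the limit value at [g]. *)
exists (fun g => x (idx g).+1 g) => B /nbhs_agree[n nB].
apply: filterS (xF n) => y xy; apply: nB => i ilt.
have [y' [xy' xny']] := filter_ex (filterI (xF (idx (e i)).+1) (xF n)).
by rewrite -xy// -{2}[e i]eidx xy' ?eidx ?xny'.
Qed.

Lemma config_metric_separable : exists2 D : set M, countable D & dense D.
Proof.
exists (range (fun (t : seq 'I_k.+1) g => nth ord0 t (idx g))).
  by apply: (card_le_trans (card_image_le _ _)); exact: countableP.
move=> O [x Ox] oO.
have /nbhs_agree[n nO] : nbhs x O by exact: open_nbhs_nbhs.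
(* As [e] may repeat values, [idx (e i)] can differ from [i]; the list has to reach past all these
   indices. *)
pose B := (\max_(i < n) idx (e i)).+1.
exists (fun g => nth ord0 (mkseq (fun m => x (e m)) B) (idx g)).
split; last by exists (mkseq (fun m => x (e m)) B).
apply: nO => i ilt; rewrite nth_mkseq ?eidx// ltnS.
exact: (leq_bigmax (Ordinal ilt)).
Qed.

Lemma cylset_open (A : set (config Gamma k)) : cylset A -> open (A : set M).
Proof.
move=> [s sA]; rewrite openE => z Az.
pose B := (\max_(g <- s) idx g).+1.
apply: filterS (agree_nbhs z B) => z' zz'; rewrite -(sA z z')// => g gs.
by rewrite -[g]eidx zz'// ltnS; exact: leq_bigmax_seq.
Qed.

(** There are only countably many cylinders, and an open set is the union of those that it
    contains. *)
Lemma open_measurable_config (A : set M) : open A ->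
  measurable (A : set (config_borel Gamma k)).
Proof.
rewrite openE => oA.
pose F n : set (config_borel Gamma k) :=
  if `[< @enum_cyl _ k e n `<=` A >] then @enum_cyl _ k e n else set0.
rewrite (_ : A = \bigcup_n F n).
  apply: bigcupT_measurable => n; rewrite /F; case: ifPn => // _.
  by apply: cylset_measurable; exact: cylset_enum_cyl.
apply/seteqP; split => z; last first.
  by move=> [n _]; rewrite /F; case: asboolP => // + zn; exact.
move=> Az; have [n nA] := nbhs_agree (oA _ Az).
have [m mE] := enum_cylP esurj [seq (e i, z (e i)) | i <- iota 0 n].
have cylE : @enum_cyl _ k e m = agree n z.
  rewrite mE; apply/seteqP; split => y yz.
    move=> i ilt; apply/esym/(yz (e i, z (e i))).
    by apply: (map_f (fun i => (e i, z (e i)))); rewrite mem_iota.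
  by move=> _ /mapP[i + ->] /=; rewrite mem_iota => /yz.
by exists m => //; rewrite /F cylE asboolT//.
Qed.

(** This makes the hypothesis on ergodic actions, which is restricted to standard Borel spaces,
    applicable to the shift. *)
Lemma standard_borel_config : standard_borel R (config_borel Gamma k).
Proof.
exists M; split.
- exact: config_metric_complete.
- exact: config_metric_separable.
exists (id : config_borel Gamma k -> M); first by exists id.
move=> A; rewrite image_id; split.
  apply: smallest_sub; first exact: smallest_sigma_algebra.
  by move=> B cB; apply: sub_sigma_algebra; exact: cylset_open.
apply: smallest_sub; first exact: sigma_algebra_measurable.
exact: open_measurable_config.
Qed.

End ConfigMetric.

(** * Gluing labelings over the unit interval *)

Section FrankWolfe.
Context (R : realType) (J : finType).

(* Each step moves along an element that does not increase the inner product
   with the current error, so the squared error of the sum grows linearly while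
   the squared number of summands grows quadratically. *)
Lemma frank_wolfe (E : set (J -> R)) (v : J -> R) :
  (forall u, E u -> forall j, `|u j - v j| <= 1) ->
  (forall c : J -> R, exists2 u, E u & \sum_j c j * u j <= \sum_j c j * v j) ->
  forall n, exists2 u : nat -> J -> R, forall m, E (u m) &
    \sum_j (\sum_(m < n) (u m j - v j)) ^+ 2 <= n%:R * #|J|%:R.
Proof.
move=> E1 Emin; elim => [|n [u uE un]].
  have [u uE _] := Emin (fun=> 0); exists (fun=> u) => //.
  by rewrite mul0r; under eq_bigr do rewrite big_ord0 expr0n; rewrite big1.
pose S j := \sum_(m < n) (u m j - v j).
have [w wE wS] := Emin S.
exists (fun m => if (m < n)%N then u m else w).
  by move=> m; case: ifP.
have SE j : \sum_(m < n.+1) ((if (m < n)%N then u m else w) j - v j) = S j + (w j - v j).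
  rewrite big_ord_recr/= ltnn; congr (_ + _); apply: eq_bigr => m _.
  by rewrite ltn_ord.
under eq_bigr do rewrite SE sqrrD.
rewrite big_split big_split/= -natr1 mulrDl mul1r.
have S2 : \sum_j S j * (w j - v j) *+ 2 <= 0.
  rewrite sumrMnl pmulrn_lle0//.
  by under eq_bigr do rewrite mulrBr; rewrite sumrB subr_le0.
have w1 : \sum_j (w j - v j) ^+ 2 <= #|J|%:R.
  rewrite -sum1_card natr_sum; apply: ler_sum => j _.
  rewrite -(real_normK (num_real _)) expr_le1//; exact: E1.
apply: lerD; last exact: w1.
by rewrite -[leRHS]addr0; apply: lerD; [exact: un|exact: S2].
Qed.

End FrankWolfe.

Section UniformLabeling.
Variable R : realType.
Local Notation iota := (iota_measure R).

Lemma iota_itv (a b : R) : 0 <= a -> a <= b -> b <= 1 ->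
  pr iota `[a, b[ = b - a.
Proof.
move=> a0 ab b1; rewrite /pr /iota_measure /= /uniform_prob.
rewrite integral_uniform_pdf setIidl; last first.
  move=> x; rewrite /= !in_itv/= => /andP[ax xb].
  by rewrite (le_trans a0 ax) (le_trans (ltW xb)).
rewrite (eq_integral (cst 1%:E)); last first.
  move=> x /set_mem; rewrite /= in_itv/= => /andP[ax xb].
  by rewrite /uniform_pdf (le_trans a0 ax) (le_trans (ltW xb) b1) subr0 invr1.
rewrite integral_cst//= lebesgue_measure_itv/= lte_fin.
move: ab; rewrite le_eqVlt => /predU1P[->|ab]; last by rewrite ab mul1e.
by rewrite ltxx mule0 subrr.
Qed.

Lemma uniform_labeling n : exists2 tau : measurableTypeR R -> 'I_n.+1,
  measurable_labeling tau & forall i, pr iota (tau @^-1` [set i]) = n.+1%:R^-1.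
Proof.
pose N : R := n.+1%:R.
have N0 : 0 < N by rewrite ltr0n.
pose K (i : 'I_n.+1) : set (measurableTypeR R) := `[i%:R / N, i.+1%:R / N[%classic.
have mK i : measurable (K i) by exact: measurable_itv.
have KP x i : K i x -> forall j, K j x -> i = j.
  rewrite /K /= => + j; rewrite !in_itv/= !ler_pdivrMr// !ltr_pdivlMr//.
  move=> /andP[ix xi] /andP[jx xj]; apply/val_inj/eqP.
  rewrite eqn_leq -[(i <= j)%N]ltnS -[(j <= i)%N]ltnS -!(ltr_nat R).
  by rewrite (le_lt_trans ix xj) (le_lt_trans jx xi).
(* Points outside the unit interval get the default label 0. *)
pose tau x := if [pick i | `[< K i x >]] is Some i then i else ord0.
have tauE i x : K i x -> tau x = i.
  move=> Kix; rewrite /tau; case: pickP => [j /asboolP Kjx|/(_ i)].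
    exact: KP Kjx _ Kix.
  by move/asboolP.
have mtau : measurable_labeling tau.
  have mU : measurable (\bigcup_i K i).
    by apply: fin_bigcup_measurable => // i _; exact: mK.
  move=> i; rewrite (_ : _ @^-1` _ =
      K i `|` (~` (\bigcup_i K i) `&` [set _ | i = ord0])).
    apply: measurableU => //; apply: measurableI; first exact: measurableC.
    have [->|i0] := eqVneq i ord0.
      by rewrite (_ : [set _ | _] = setT)//; apply/seteqP; split.
    by rewrite (_ : [set _ | _] = set0)//; apply/seteqP; split => // x /=; move/eqP: i0.
  apply/seteqP; split => x /=; last first.
    move=> [/tauE //|[nK ->]]; rewrite /tau; case: pickP => // j /asboolP Kj.
    by case: nK; exists j.
  move=> <-; rewrite /tau; case: pickP => [j /asboolP Kj|nK]; first by left.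
  by right; split => // -[j _ Kj]; have := nK j; rewrite asboolT.
exists tau => // i.
have Kpr j : pr iota (K j) = N^-1.
  rewrite iota_itv.
  - by rewrite -mulrBl -natr1 addrC addKr mul1r.
  - by rewrite divr_ge0.
  - by rewrite ler_pM2r ?invr_gt0// ler_nat.
  - by rewrite ler_pdivrMr// mul1r ler_nat.
(* These lower bounds already add up to the total mass 1, so each is an equality; this avoids
   computing the mass outside the intervals. *)
have ge_pr j : N^-1 <= pr iota (tau @^-1` [set j]).
  by rewrite -(Kpr j); apply: le_pr => // x; exact: tauE.
have sum_pr : \sum_j pr iota (tau @^-1` [set j]) = 1.
  rewrite -[RHS](mean_cst iota 1) (mean_labeling iota (fun=> 1) mtau).
  by apply: eq_bigr => j _; rewrite mul1r.
apply/eqP; rewrite eq_le ge_pr andbT -(lerD2r (\sum_(j | j != i) N^-1)).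
have -> : N^-1 + \sum_(j < n.+1 | j != i) N^-1 = 1.
  have : \sum_(j < n.+1) N^-1 = 1.
    by rewrite sumr_const card_ord -[LHS]mulr_natl divff ?gt_eqF.
  by rewrite (bigD1 i).
rewrite -sum_pr [leRHS](bigD1 i)//= lerD2l.
by apply: ler_sum => j _; exact: ge_pr.
Qed.

End UniformLabeling.

Lemma pr_split (R : realType) d (X : measurableType d) (P : probability X R)
    (L : finType) (si : X -> L) (A : set X) :
  measurable_labeling si -> measurable A ->
  pr P A = \sum_l pr P (A `&` si @^-1` [set l]).
Proof.
move=> msi mA.
have mAl l : measurable (A `&` si @^-1` [set l]) by exact: measurableI.
rewrite -mean_indic// (eq_bigr (fun l => \int[P]_x \1_(A `&` si @^-1` [set l]) x)).
  rewrite -mean_sum; last by move=> l; exact: bmeas_indic.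
  apply: eq_Rintegral => x _; rewrite (bigD1 (si x))//= big1 ?addr0.
    rewrite !indicE; congr ((nat_of_bool _)%:R); apply/idP/idP => /set_mem Ax.
      by rewrite mem_set.
    by rewrite mem_set//; case: Ax.
  move=> l /eqP lx; rewrite indicE memNset// => -[_ /= xl].
  by apply: lx.
by move=> l _; rewrite mean_indic.
Qed.

Section Gluing.
Context (Gamma : groupType) (R : realType).
Context dZ (Z : measurableType dZ) (zeta : probability Z R).
Context dY (Y : measurableType dY) (nu : probability Y R).
Variables (c : mp_action Gamma zeta) (q : mp_action Gamma nu).
Hypothesis c_id : forall g z, c g z = z.
Variables (I L : finType) (tau : Z -> I) (be : I -> Y -> L).
Hypothesis mtau : measurable_labeling tau.
Hypothesis mbe : forall m, measurable_labeling (be m).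

Definition glue (w : Z * Y) : L := be (tau w.1) w.2.

Let mfst : measurable_labeling (fun w : Z * Y => tau w.1).
Proof.
move=> m; rewrite (_ : _ @^-1` _ = (tau @^-1` [set m]) `*` setT).
  exact: measurableX.
by apply/seteqP; split => w //= [].
Qed.

Lemma measurable_glue : measurable_labeling glue.
Proof.
move=> l; rewrite (_ : _ @^-1` _ =
    \bigcup_m ((tau @^-1` [set m]) `*` (be m @^-1` [set l]))).
  apply: fin_bigcup_measurable => // m _; apply: measurableX; first exact: mtau.
  exact: mbe.
apply/seteqP; split => w /=; first by move=> wl; exists (tau w.1).
by move=> [m _ [/= wm wl]]; rewrite /glue wm.
Qed.

(** Points of [Z] are fixed, so the strip over each piece of [tau] is invariant, and on it the
    second coordinate moves by [q] and is labeled by [be m]. *)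
Lemma pr_glue g i j :
  pr (product_probability zeta nu)
    [set w | glue (prod_action c q g w) = i /\ glue w = j] =
  \sum_m pr zeta (tau @^-1` [set m]) *
    pr nu [set y | be m (q g y) = i /\ be m y = j].
Proof.
have mS m : measurable [set y | be m (q g y) = i /\ be m y = j].
  apply: measurableI; last exact: mbe.
  exact: (labeling_act q g (@mbe m) i).
have mW : measurable [set w | glue (prod_action c q g w) = i /\ glue w = j].
  apply: measurableI; last exact: measurable_glue.
  exact: (labeling_act (prod_action c q) g measurable_glue i).
rewrite (pr_split _ mfst mW); apply: eq_bigr => m _.
rewrite (_ : _ `&` _ =
    (tau @^-1` [set m]) `*` [set y | be m (q g y) = i /\ be m y = j]).
  apply: EFin_inj; rewrite EFinM -!prE//; last first.
    by apply: measurableX => //; exact: mtau.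
  by rewrite /product_probability /= product_measure1E//; exact: mtau.
apply/seteqP; split => w; rewrite /glue /= /prod_act /= c_id.
  by move=> [] /[swap] ->.
by move=> [->].
Qed.

End Gluing.

(** * From ergodic actions to all actions, and the equivalence *)

Theorem wc_iota_prod (Gamma : groupType) (R : realType)
    dY (Y : measurableType dY) (nu : probability Y R) (q : mp_action Gamma nu) :
  countable [set: Gamma] ->
  (forall d (X : measurableType d) (mu : probability X R) (b : mp_action Gamma mu),
    standard_borel R X -> ergodic b -> b ≺ q) ->
  forall d (X : measurableType d) (mu : probability X R) (b : mp_action Gamma mu),
    b ≺ prod_action (iota_action Gamma R) q.
Proof.
move=> cGamma EMD d X mu b k A F eps /partition_labeling[al mal AE].
move=> /finite_seqP[s ->{F}] eps0.
have [x0 _] := probability_nonempty mu.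
(* A probability space is nonempty, so there is at least one piece, and the alphabet has the form
   ['I_k.+1] that configurations require. *)
case: k A al mal AE => [A al|k A al mal AE]; first by case: (al x0).
pose J := ('I_(size s) * 'I_k.+1 * 'I_k.+1)%type.
pose g_ (j : J) : Gamma := (tnth (in_tuple s) j.1.1)^-1%g.
pose C (j : J) : set (config Gamma k) := [set z | z (g_ j) = j.1.2 /\ z 1%g = j.2].
have cC j : cylset (C j).
  by apply: (@measurableI _ (config Gamma k)); exact: cylset_coord.
pose v (j : J) := factor_mean b al (C j).
have mv := factor_cyl_mean b mal.
(* The correlation vectors of ergodic shift-invariant measures. By [exists_ergodic_le] no linear
   functional separates [v] from them, which is what [frank_wolfe] asks for. *)
pose E := [set u : J -> R | exists (P : probability (config_borel Gamma k) R)
  (c : mp_action Gamma P),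
  [/\ forall g, c g = shift g, ergodic c & forall j, u j = pr P (C j)]].
have E1 u : E u -> forall j, `|u j - v j| <= 1.
  move=> [P [c [_ _ uE]]] j; have [/(_ (C j)) /andP[v0 v1] _ _ _] := mv.
  have mC := cylset_measurable (cC j).
  rewrite uE ler_norml; have := pr_ge0 P (C j); have := pr_le1 P mC.
  by rewrite -/(v j) in v0 v1 *; lra.
have Emin (c : J -> R) : exists2 u, E u & \sum_j c j * u j <= \sum_j c j * v j.
  have [P [c' [c'E erg le_c]]] := exists_ergodic_le c cGamma cC mv.
  by exists (fun j => pr P (C j)) => //; exists P, c'.
(* For [N] summands [frank_wolfe] bounds the squared error by [N * #|J|], which is below
   [(N * (eps / 2)) ^+ 2] once [N] exceeds [#|J| / (eps / 2) ^+ 2]. *)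
pose n := Num.bound (#|{: J}|%:R / (eps / 2) ^+ 2).
pose N : R := n.+1%:R.
have N0 : 0 < N by rewrite ltr0n.
have eps2 : 0 < eps / 2 by rewrite divr_gt0.
have [u uE un] := frank_wolfe E1 Emin n.+1.
have vu j : `|\sum_(m < n.+1) (u m j - v j)| < N * (eps / 2).
  apply: sqr_lt_norm; first by rewrite mulr_gt0.
  apply: (@le_lt_trans _ _ (N * #|{: J}|%:R)).
    apply: le_trans un; rewrite (bigD1 j)//= lerDl.
    by apply: sumr_ge0 => *; exact: sqr_ge0.
  rewrite exprMn [N ^+ 2]expr2 -mulrA ltr_pM2l// -ltr_pdivrMr ?exprn_gt0//.
  apply: (lt_le_trans (archi_boundP _)); first by rewrite divr_ge0// sqr_ge0.
  by rewrite ler_nat leqW.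
have [e esurj] := countable_enum cGamma.
have /choice[be beP] : forall m, exists be : Y -> 'I_k.+1, measurable_labeling be /\
    forall j, `|u m j - pr nu [set y | be (q (g_ j) y) = j.1.2 /\ be y = j.2]| < eps / 2.
  move=> m; have [P [c [cE erg uP]]] := uE m.
  have cq := EMD _ _ _ c (standard_borel_config R k esurj) erg.
  (* Labeling a configuration by its value at the identity turns the masses of the sets [C j] into
     correlations under the shift. *)
  pose z1 (z : config_borel Gamma k) := z 1%g.
  have mz1 : measurable_labeling z1.
    by move=> i; apply: cylset_measurable; exact: cylset_coord.
  have [be mbe beP] := wc_labeling cq [seq g^-1%g | g <- s] mz1 eps2.
  exists be; split => // j.
  have gs : g_ j \in [seq g^-1%g | g <- s].
    exact: (map_f _ (mem_tnth j.1.1 (in_tuple s))).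
  rewrite uP (_ : C j = [set z | z1 (c (g_ j) z) = j.1.2 /\ z1 z = j.2]).
    exact: beP.
  by rewrite /C /z1 cE /shift mul1g.
have [tau mtau tauE] := uniform_labeling R n.
pose ga := glue tau (fun m : 'I_n.+1 => be m).
have mga : measurable_labeling ga.
  by apply: measurable_glue => // m; have [] := beP m.
exists (fun i => ga @^-1` [set i]); first exact: labeling_partition.
move=> h i l hs.
have /tnthP[r hr] : h \in in_tuple s by [].
pose j : J := (r, i, l).
have mA : measurable (b (g_ j) @^-1` (al @^-1` [set i]) `&` al @^-1` [set l]).
  by apply: measurableI; [exact: measurable_act_preimage|].
have mB : measurable (prod_action (iota_action Gamma R) q (g_ j) @^-1`
    (ga @^-1` [set i]) `&` ga @^-1` [set l]).
  by apply: measurableI; [exact: measurable_act_preimage|].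
rewrite !act_image !AE hr -[(tnth _ _)^-1%g]/(g_ j) !prE// abse_EFin lte_fin.
have -> : pr mu (b (g_ j) @^-1` (al @^-1` [set i]) `&` al @^-1` [set l]) = v j.
  rewrite /v factor_meanE//; congr pr; apply/seteqP; split => x /=;
    by rewrite /C /conf /= act1.
have -> : pr (product_probability (iota_measure R) nu)
    (prod_action (iota_action Gamma R) q (g_ j) @^-1` (ga @^-1` [set i]) `&`
      ga @^-1` [set l]) =
    N^-1 * \sum_(m < n.+1) pr nu [set y | be m (q (g_ j) y) = i /\ be m y = l].
  rewrite (@pr_glue _ _ _ _ _ _ _ _ (iota_action Gamma R) q _ _ _ tau
    (fun m : 'I_n.+1 => be m) mtau)//.
    by rewrite mulr_sumr; apply: eq_bigr => m _; rewrite tauE.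
  by move=> m; have [] := beP m.
rewrite -(ltr_pM2l N0) -[X in X * _]gtr0_norm// -normrM mulrBr mulVKf ?gt_eqF//.
rewrite distrC.
have -> : N * v j = \sum_(m < n.+1) v j.
  by rewrite sumr_const card_ord mulr_natl.
rewrite -sumrB.
(* Half of the error comes from replacing ergodic measures by labelings that approximate them, half
   from averaging the ergodic correlations in place of [v]. *)
under eq_bigr => m _ do rewrite -(subrKA (u m j)).
rewrite big_split/= (le_lt_trans (ler_normD _ _))//.
rewrite [ltRHS](_ : _ = N * (eps / 2) + N * (eps / 2)); last by field.
rewrite ler_ltD//.
rewrite (le_trans (ler_norm_sum _ _ _))//.
rewrite (_ : N * (eps / 2) = \sum_(m < n.+1) (eps / 2)); last first.
  by rewrite sumr_const card_ord mulr_natl.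
apply: ler_sum => m _; rewrite distrC; apply: ltW.
by have [_ /(_ j)] := beP m.
Qed.

Theorem theorem1p4 (R : realType) (Gamma : groupType)
    (Gamma_countable : countable [set: Gamma])
    (Gamma_infinite : infinite_set [set: Gamma]) :
  MD Gamma R <-> EMD_star Gamma R.
Proof.
split=> [md|emd] m d X mu b sX.
  move=> erg; apply: (ergodic_wc_prod (c := iota_action Gamma R)) => //.
  exact: md.
by apply: wc_iota_prod => // d' X' mu' b'; exact: emd.
Qed.
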